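(* Let $d\ge 2$ be an integer. Then $$\lim_{n\to\infty} n\cdot\operatorname{disp}_{\mathcal C}(n,d)=\vartheta_d .$$
   Context: $\mathbb S^d\subset\mathbb R^{d+1}$ is the Euclidean unit sphere, $\sigma$ the normalized (total mass $1$) Lebesgue surface measure on $\mathbb S^d$. The family of spherical caps is $\mathcal C=\{B(x,\varphi):x\in\mathbb S^d,\varphi\in[0,\pi]\}$, where $B(x,\varphi)=\{y\in\mathbb S^d:\arccos\langle x,y\rangle\le\varphi\}$. The minimal spherical cap dispersion is $$\operatorname{disp}_{\mathcal C}(n,d)=\inf_{x_1,\dots,x_n\in\mathbb S^d}\ \sup\{\sigma(C): C\in\mathcal C,\ C\cap\{x_1,\dots,x_n\}=\emptyset\}.$$ Let $B^d(x,r)$ denote the Euclidean ball in $\mathbb R^d$ with center $x$ and radius $r$, and $\mathrm{vol}_d$ the $d$-dimensional Lebesgue measure. The minimal covering density of $\mathbb R^d$ by equal balls is $$\vartheta_d=\inf_{\mathcal B}\ \lim_{R\to\infty}\ \sum_{B\in\mathcal B}\frac{\mathrm{vol}_d(B\cap B^d(0,R))}{\mathrm{vol}_d(B^d(0,R))},$$ where the infimum is over all coverings $\mathcal B=\{B^d(x_1,1),B^d(x_2,1),\dots\}$ of $\mathbb R^d$ by Euclidean balls of unit radius for which the limit exists. *)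

(* Defs.v *)
From HB Require Import structures.
From mathcomp Require Import all_boot all_order all_algebra.
From mathcomp Require Import all_classical all_reals all_analysis.
Import Order.TTheory GRing.Theory Num.Theory.
Import numFieldNormedType.Exports.

Set Implicit Arguments.
Unset Strict Implicit.
Unset Printing Implicit Defensive.

Local Open Scope classical_set_scope.
Local Open Scope ring_scope.

Definition tuple_cons (T : Type) (n : nat) (p : T * n.-tuple T) :
  n.+1.-tuple T := [the n.+1.-tuple T of p.1 :: p.2].

Lemma measurable_tuple_cons d (T : measurableType d) n :
  measurable_fun [set: T * n.-tuple T] (@tuple_cons T n).
Proof. exact: measurable_cons. Qed.

Section lebesgue_succ.
Context (R : realType) (n : nat).
Let T := measurableTypeR R.
Variable m : {sigma_finite_measure set (n.-tuple T) -> \bar R}.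

Definition lebesgue_succ : set (n.+1.-tuple T) -> \bar R :=
  pushforward (lebesgue_measure \x m)%E (@tuple_cons T n).

Let lebesgue_succ0 : lebesgue_succ set0 = 0%E.
Proof. by rewrite /lebesgue_succ /pushforward preimage_set0 measure0. Qed.

Let lebesgue_succ_ge0 A : (0 <= lebesgue_succ A)%E.
Proof. by rewrite /lebesgue_succ /pushforward; apply: integral_ge0. Qed.

Let lebesgue_succ_sigma_additive : semi_sigma_additive lebesgue_succ.
Proof.
pose mf := @measurable_tuple_cons _ T n.
move=> F mF tF mUF; rewrite /lebesgue_succ /pushforward preimage_bigcup.
apply: measure_semi_sigma_additive.
- by move=> k; rewrite -[X in measurable X]setTI; exact: mf.
- apply/trivIsetP => /= i j _ _ ij; rewrite -preimage_setI.
  by move/trivIsetP : tF => /(_ _ _ _ _ ij) ->//; rewrite preimage_set0.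
- by rewrite -preimage_bigcup -[X in measurable X]setTI; exact: mf.
Qed.

HB.instance Definition _ := isMeasure.Build _ _ _ lebesgue_succ
  lebesgue_succ0 lebesgue_succ_ge0 lebesgue_succ_sigma_additive.

Let lebesgue_succ_sigma_finite : sigma_finite setT lebesgue_succ.
Proof.
have /sigma_finiteP[F [TF ndF Foo]] := sigma_finiteT (@lebesgue_measure R).
have /sigma_finiteP[G [TG ndG Goo]] := sigma_finiteT m.
pose g (t : n.+1.-tuple T) : T * n.-tuple T := (thead t, [tuple of behead t]).
have mg : measurable_fun [set: n.+1.-tuple T] g.
  apply/measurable_fun_pairP; split; last exact: measurable_behead.
  exact: measurable_tnth.
have gK : cancel (@tuple_cons T n) g.
  by move=> [x t]; rewrite /g /tuple_cons/=; congr pair; exact/val_inj.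
exists (fun k => g @^-1` (F k `*` G k)).
  rewrite -preimage_bigcup; apply/esym/seteqP; split=> // t _.
  have [i _ Fi] : (\bigcup_i F i) (g t).1 by rewrite -TF.
  have [j _ Gj] : (\bigcup_i G i) (g t).2 by rewrite -TG.
  exists (maxn i j) => //; split.
  - by move: Fi; exact/subsetPset/ndF/leq_maxl.
  - by move: Gj; exact/subsetPset/ndG/leq_maxr.
move=> k; have [mF Fk] := Foo k; have [mG Gk] := Goo k; split.
  by rewrite -[X in measurable X]setTI; apply: mg => //; exact: measurableX.
rewrite /lebesgue_succ /pushforward (_ : _ @^-1` _ = F k `*` G k); last first.
  by rewrite -comp_preimage; apply/seteqP; split => y; rewrite /preimage /mkset /comp gK.
by rewrite product_measure1E// lte_mul_pinfty// ge0_fin_numE.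
Qed.

HB.instance Definition _ := Measure_isSigmaFinite.Build _ _ _ lebesgue_succ
  lebesgue_succ_sigma_finite.

End lebesgue_succ.

(* n-fold product of the Lebesgue measure; for n = 0, the unit mass on the
   one-point space. *)
Fixpoint lebesgue_tuple (R : realType) (n : nat) :
    {sigma_finite_measure set (n.-tuple (measurableTypeR R)) -> \bar R} :=
  if n is n'.+1 then lebesgue_succ (lebesgue_tuple R n')
  else (\d_([tuple] : 0.-tuple (measurableTypeR R)))%E.

Section geometry.
Variable R : realType.

Definition vol (d : nat) (A : set 'rV[R]_d) : \bar R :=
  lebesgue_tuple R d [set t | A (\row_i tnth t i)].

Definition inner (d : nat) (x y : 'rV[R]_d) : R := \sum_i x ord0 i * y ord0 i.

(* The library's norm on ['rV[R]_d] is the sup norm. *)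
Definition enorm (d : nat) (x : 'rV[R]_d) : R := Num.sqrt (inner x x).

Definition eball (d : nat) (c : 'rV[R]_d) (r : R) : set 'rV[R]_d :=
  [set y | enorm (y - c) <= r].

Definition sphere (d : nat) : set 'rV[R]_d.+1 := [set x | enorm x = 1].
Arguments sphere : clear implicits.

Definition cone (d : nat) (A : set 'rV[R]_d) : set 'rV[R]_d :=
  [set v | exists t x, [/\ 0 <= t <= 1, A x & v = t *: x]].

(* Surface measure on the sphere in polar coordinates: the surface measure of
   [A] is [d.+1] times the volume of the cone over [A], and normalizing to total
   mass 1 divides this by its value at the whole sphere, whose cone is the unit
   ball. *)
Definition sigma (d : nat) (A : set 'rV[R]_d.+1) : \bar R :=
  (vol (cone (A `&` sphere d)) / vol (eball 0 1 : set 'rV[R]_d.+1))%E.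

Definition cap (d : nat) (x : 'rV[R]_d.+1) (phi : R) : set 'rV[R]_d.+1 :=
  [set y | sphere d y /\ acos (inner x y) <= phi].

Definition caps (d : nat) : set (set 'rV[R]_d.+1) :=
  [set C | exists x phi, [/\ sphere d x, 0 <= phi <= pi & C = cap x phi]].
Arguments caps : clear implicits.

Definition disp (n d : nat) : \bar R :=
  ereal_inf [set ereal_sup [set sigma C | C in
                 [set C | caps d C /\ C `&` range x = set0]]
            | x in [set x : 'I_n -> 'rV[R]_d.+1 | forall i, sphere d (x i)]].

(* A covering is a set of balls, so each ball contributes once to the density:
   the enumeration of the centers is without repetition. (No finite family of
   unit balls covers the space when [0 < d].) *)
Definition unit_ball_covering (d : nat) (x : nat -> 'rV[R]_d) : Prop :=
  injective x /\ \bigcup_i eball (x i) 1 = setT.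

Definition has_covering_density (d : nat) (x : nat -> 'rV[R]_d)
    (l : \bar R) : Prop :=
  (fun r : R => \sum_(0 <= i <oo)
      (vol (eball (x i) 1 `&` eball 0 r) / vol (eball 0 r : set 'rV[R]_d)))%E
    @ +oo --> l.

Definition covering_density (d : nat) : \bar R :=
  ereal_inf [set l | exists x : nat -> 'rV[R]_d,
                       unit_ball_covering x /\ has_covering_density x l].

End geometry.

(* Main.v *)
(* A configuration of [n] points leaves no empty cap of a given radius exactly
   when the caps of that radius around the points cover the sphere, so
   [n * disp n] is asymptotically the least density of a covering of the sphere
   by [n] equal caps. The sphere is compared with [R^d] through the gnomonic
   projection from a point: it is nearly isometric near that point, and the cone
   over a small set lies between two pyramids over its image, so that it is also
   nearly volume preserving up to a constant factor.

   Lower bound: if [n] caps of gnomonic radius [t] cover the sphere, some cap of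
   radius [rho * t] contains at most the average number of points, and its
   projection yields a covering of a Euclidean ball of radius about [rho] by few
   unit balls. Averaging over translates gives an equally economical covering of
   a cube, and repeating it periodically a covering of [R^d] whose density exists.

   Upper bound: cover the sphere by finitely many small caps and cut it into the
   sectors of each cap missed by the previous ones. In the projection of each
   sector use a scaled translate of a good covering of [R^d], chosen by averaging
   so that few centers lie near the sector. The sectors enlarged by a small
   margin overlap only in thin shells around the boundaries of the caps. *)
Require Import Defs.
From HB Require Import structures.
From mathcomp Require Import all_boot all_order all_algebra finmap.
From mathcomp Require Import all_classical all_reals all_analysis.
From mathcomp Require Import measurable_realfun zify ring lra.
Import Order.TTheory GRing.Theory Num.Theory.
Import numFieldNormedType.Exports.

Set Implicit Arguments.
Unset Strict Implicit.
Unset Printing Implicit Defensive.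

Local Open Scope classical_set_scope.
Local Open Scope ring_scope.

(** * Lebesgue measure on row vectors *)

(** No volume of a ball or a cap is ever evaluated. The measure of a cap of gnomonic radius [t] is
    to leading order a constant times [t ^+ d], so the radius matched with [n] points is defined by
    an equation [t ^+ d = const / n], and the constants cancel when points are counted against
    Euclidean balls. What remains is a fixed number of factors tending to 1, each bounded by a
    constant that may be chosen arbitrarily close to 1 beforehand.

    The two directions are not symmetric. The infimum in [covering_density] ranges over coverings
    whose density limit exists, so bounding it from above requires a covering with a provable limit,
    hence a periodic one. In the other direction the limit is given, and it is used only to bound
    the number of centers in large balls.

    Moving an arbitrary point of the sphere to the pole requires that [vol], built one coordinate at
    a time, be invariant under reflections. This is derived from its translation invariance
    alone. *)

Section row_vector.
Context (R : realType).
Let T := measurableTypeR R.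

Definition rowv (d : nat) (t : d.-tuple T) : 'rV[R]_d := \row_i tnth t i.
Definition tupv (d : nat) (v : 'rV[R]_d) : d.-tuple T := [tuple v 0 i | i < d].

Lemma rowvK d : cancel (@rowv d) (@tupv d).
Proof. by move=> t; apply: eq_from_tnth => i; rewrite tnth_mktuple mxE. Qed.

Lemma tupvK d : cancel (@tupv d) (@rowv d).
Proof. by move=> v; apply/rowP => i; rewrite mxE tnth_mktuple. Qed.

(** The sigma-algebra transported along [rowv]: a set of rows is measurable exactly when [vol]
    evaluates the tuple measure on a measurable set. *)
Definition row_measurable d : set (set 'rV[R]_d) :=
  [set A | measurable (@rowv d @^-1` A)].

Let row_measurable0 d : row_measurable (set0 : set 'rV[R]_d).
Proof. by rewrite /row_measurable /= preimage_set0. Qed.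

Let row_measurableC d (A : set 'rV[R]_d) :
  row_measurable A -> row_measurable (~` A).
Proof. by rewrite /row_measurable /= => mA; rewrite preimage_setC; exact: measurableC. Qed.

Let row_measurable_bigcup d (F : (set 'rV[R]_d)^nat) :
  (forall i, row_measurable (F i)) -> row_measurable (\bigcup_i F i).
Proof.
by rewrite /row_measurable /= => mF; rewrite preimage_bigcup; exact: bigcup_measurable.
Qed.

HB.instance Definition _ d := @isMeasurable.Build
  default_measure_display 'rV[R]_d
  (@row_measurable d) (@row_measurable0 d) (@row_measurableC d)
  (@row_measurable_bigcup d).

End row_vector.

Section measurability.
Context (R : realType).
Local Notation T := (measurableTypeR R).

Lemma measurable_rowv d : measurable_fun [set: d.-tuple T] (@rowv R d).
Proof. by move=> _ A mA; rewrite setTI. Qed.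

Lemma measurable_coord d (i : 'I_d) :
  measurable_fun [set: 'rV[R]_d] (fun v => v 0 i : R).
Proof.
move=> _ A mA; rewrite setTI.
have := @measurable_tnth _ T d i measurableT A mA; rewrite setTI => mtA.
suff : measurable (@rowv R d @^-1` [set v : 'rV[R]_d | A (v 0 i)]) by [].
rewrite (_ : _ @^-1` _ = (@tnth _ T)^~ i @^-1` A)//.
by apply/seteqP; split=> t /=; rewrite mxE.
Qed.

Lemma measurable_rowP d d' (X : measurableType d') (f : X -> 'rV[R]_d) :
  (forall i, measurable_fun [set: X] (fun x => f x 0 i)) ->
  measurable_fun [set: X] f.
Proof.
move=> mf.
have mt : measurable_fun [set: X] (fun x => tupv (f x) : d.-tuple T).
  apply/measurable_fun_tnthP => i.
  rewrite (_ : _ \o _ = fun x => f x 0 i); first exact: mf.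
  by apply: funext => x /=; rewrite tnth_mktuple.
rewrite (_ : f = @rowv R d \o (fun x => tupv (f x))).
  by apply: measurableT_comp => //; exact: measurable_rowv.
by apply: funext => x /=; rewrite tupvK.
Qed.

Section ops.
Context (d : nat) d' (X : measurableType d').
Implicit Types f g : X -> 'rV[R]_d.

Lemma measurable_coord_comp f i : measurable_fun [set: X] f ->
  measurable_fun [set: X] (fun x => f x 0 i).
Proof. by move=> mf; exact: (measurableT_comp (measurable_coord i) mf). Qed.

Lemma measurable_rowD f g : measurable_fun [set: X] f ->
  measurable_fun [set: X] g -> measurable_fun [set: X] (fun x => f x + g x).
Proof.
move=> mf mg; apply: measurable_rowP => i.
rewrite (_ : (fun _ => _) = (fun x => f x 0 i) \+ (fun x => g x 0 i)).
  by apply: measurable_funD; exact: measurable_coord_comp.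
by apply: funext => x; rewrite mxE.
Qed.

Lemma measurable_rowZ (a : X -> R) f : measurable_fun [set: X] a ->
  measurable_fun [set: X] f -> measurable_fun [set: X] (fun x => a x *: f x).
Proof.
move=> ma mf; apply: measurable_rowP => i.
rewrite (_ : (fun _ => _) = a \* (fun x => f x 0 i)).
  by apply: measurable_funM => //; exact: measurable_coord_comp.
by apply: funext => x; rewrite mxE.
Qed.

Lemma measurable_rowB f g : measurable_fun [set: X] f ->
  measurable_fun [set: X] g -> measurable_fun [set: X] (fun x => f x - g x).
Proof.
move=> mf mg; apply: measurable_rowD => //.
rewrite (_ : (fun _ => _) = fun x => -1 *: g x); last by apply: funext=> x; rewrite scaleN1r.
exact: measurable_rowZ.
Qed.

Lemma measurable_inner f g : measurable_fun [set: X] f ->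
  measurable_fun [set: X] g -> measurable_fun [set: X] (fun x => inner (f x) (g x)).
Proof.
move=> mf mg; rewrite /inner.
apply: (@measurable_sum _ _ _ _ _ (index_enum 'I_d)
  (fun i x => f x ord0 i * g x ord0 i)) => i.
by apply: measurable_funM; exact: measurable_coord_comp.
Qed.

Lemma measurable_enorm f : measurable_fun [set: X] f ->
  measurable_fun [set: X] (fun x => enorm (f x)).
Proof.
move=> mf; rewrite /enorm.
apply: (@measurableT_comp _ _ _ _ _ _ (@Num.sqrt R)).
  apply: continuous_measurable_fun; exact: sqrt_continuous.
exact: measurable_inner.
Qed.

End ops.

Lemma measurable_le d' (X : measurableType d') (f g : X -> R) :
  measurable_fun [set: X] f -> measurable_fun [set: X] g ->
  measurable [set x | f x <= g x].
Proof. by move=> mf mg; rewrite -[X in measurable X]setTI; exact: measurable_fun_le. Qed.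

Lemma measurable_lt d' (X : measurableType d') (f g : X -> R) :
  measurable_fun [set: X] f -> measurable_fun [set: X] g ->
  measurable [set x | f x < g x].
Proof.
move=> mf mg.
rewrite (_ : mkset _ = ~` [set x | g x <= f x]).
  by apply: measurableC; exact: measurable_le.
by apply/seteqP; split => x /=; [move=> h; apply/negP; rewrite -ltNge|move/negP; rewrite -ltNge].
Qed.

Lemma measurable_eball d (c : 'rV[R]_d) r : measurable (eball c r).
Proof. by apply: measurable_le => //; apply: measurable_enorm; exact: measurable_rowB. Qed.

Lemma measurable_preimage d' d2 (X : measurableType d') (Y : measurableType d2)
  (f : X -> Y) (A : set Y) : measurable_fun [set: X] f -> measurable A ->
  measurable [set x | A (f x)].
Proof. by move=> mf mA; rewrite -[X in measurable X]setTI; exact: mf. Qed.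

End measurability.

Section vol_measure.
Context (R : realType).

Section instance.
Variable d : nat.
Let vol0 : @vol R d set0 = 0%E.
Proof. by rewrite /vol (_ : mkset _ = set0)// measure0. Qed.

Let vol_ge0 A : (0 <= @vol R d A)%E.
Proof. by rewrite /vol. Qed.

Let vol_sigma_additive : semi_sigma_additive (@vol R d).
Proof.
move=> F mF tF mUF.
rewrite (_ : @vol R d = fun A => lebesgue_tuple R d (@rowv R d @^-1` A))//.
rewrite preimage_bigcup; apply: measure_semi_sigma_additive.
- exact: mF.
- apply/trivIsetP => /= i j _ _ ij; rewrite -preimage_setI.
  by move/trivIsetP : tF => /(_ _ _ _ _ ij) ->//; rewrite preimage_set0.
- by rewrite -preimage_bigcup; exact: mUF.
Qed.

HB.instance Definition _ := isMeasure.Build _ _ _ (@vol R d)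
  vol0 vol_ge0 vol_sigma_additive.

Let vol_sigma_finite : sigma_finite setT (@vol R d).
Proof.
have /sigma_finiteP[F [TF ndF Foo]] := sigma_finiteT (lebesgue_tuple R d).
exists (fun k => @tupv R d @^-1` F k).
  by rewrite -preimage_bigcup -TF preimage_setT.
have rtF k : @rowv R d @^-1` (@tupv R d @^-1` F k) = F k.
  by apply/seteqP; split => t /=; rewrite rowvK.
move=> k; have [mF Fk] := Foo k; split.
  suff : measurable (@rowv R d @^-1` (@tupv R d @^-1` F k)) by [].
  by rewrite rtF.
by rewrite /vol -[mkset _]/(@rowv R d @^-1` _) rtF.
Qed.

HB.instance Definition _ := Measure_isSigmaFinite.Build _ _ _ (@vol R d)
  vol_sigma_finite.
End instance.

(** The coordinate split off is the first because [lebesgue_succ] conses; it later becomes the axis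
    of the gnomonic projection. *)
Definition rcons0 d (h : R) (w : 'rV[R]_d) : 'rV[R]_d.+1 :=
  \row_i (if unlift ord0 i is Some j then w 0 j else h).

Lemma rcons0_0 d h (w : 'rV[R]_d) : rcons0 h w 0 0 = h.
Proof. by rewrite mxE unlift_none. Qed.

Lemma rcons0_lift d h (w : 'rV[R]_d) j : rcons0 h w 0 (lift ord0 j) = w 0 j.
Proof. by rewrite mxE liftK. Qed.

Definition rtail d (v : 'rV[R]_d.+1) : 'rV[R]_d := \row_j v 0 (lift ord0 j).

Lemma rcons0K d h (w : 'rV[R]_d) : rtail (rcons0 h w) = w.
Proof. by apply/rowP => j; rewrite mxE rcons0_lift. Qed.

Lemma measurable_rcons0 d d' (X : measurableType d') (h : X -> R)
    (w : X -> 'rV[R]_d) : measurable_fun [set: X] h -> measurable_fun [set: X] w ->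
  measurable_fun [set: X] (fun x => rcons0 (h x) (w x)).
Proof.
move=> mh mw; apply: measurable_rowP => i; case: (unliftP ord0 i) => [j ->|->].
  under eq_fun do rewrite rcons0_lift; exact: measurable_coord_comp.
by under eq_fun do rewrite rcons0_0.
Qed.

Lemma measurable_rtail d : measurable_fun [set: 'rV[R]_d.+1] (@rtail d).
Proof.
apply: measurable_rowP => i; under eq_fun do rewrite mxE.
exact: measurable_coord.
Qed.

Local Notation mu := (@lebesgue_measure R).

(** [product_measure1] is by definition the integral of the measures of the sections. The inductions
    on the dimension go through this form. *)
Lemma vol_slice d (A : set 'rV[R]_d.+1) : measurable A ->
  vol A = (\int[mu]_h vol [set w : 'rV[R]_d | A (rcons0 h w)])%E.
Proof.
move=> mA; rewrite /vol /= /lebesgue_succ /pushforward /product_measure1.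
apply: eq_integral => h _ /=; congr (lebesgue_tuple R d _).
rewrite /xsection; apply/seteqP; split => t /=; rewrite inE /=.
  move=> At; apply: (@eq_ind _ _ A At); apply/rowP => i; rewrite !mxE.
  case: unliftP => [j ->|->] /=; last by rewrite tnth0.
  by rewrite tnthS mxE; congr tnth; exact/val_inj.
move=> At; apply: (@eq_ind _ _ A At); apply/rowP => i; rewrite !mxE.
case: unliftP => [j ->|->] /=; last by rewrite tnth0.
by rewrite tnthS mxE; congr tnth; exact/val_inj.
Qed.

Lemma measurable_slice d (A : set 'rV[R]_d.+1) h : measurable A ->
  measurable [set w : 'rV[R]_d | A (rcons0 h w)].
Proof. by move=> mA; apply: measurable_preimage => //; exact: measurable_rcons0. Qed.

Lemma measurable_vol_slice d (A : set 'rV[R]_d.+1) : measurable A ->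
  measurable_fun [set: measurableTypeR R] (fun h => vol [set w : 'rV[R]_d | A (rcons0 h w)]).
Proof.
move=> mA.
have mB : measurable [set p : measurableTypeR R * 'rV[R]_d | A (rcons0 p.1 p.2)].
  by apply: measurable_preimage => //; apply: measurable_rcons0.
have := measurable_fun_xsection (@vol R d) mB.
apply: eq_measurable_fun => h _ /=; congr vol; apply/seteqP.
by split => w /=; rewrite /xsection /= inE.
Qed.

Section affine_line.
Variables (a b : R).
Hypothesis a0 : 0 < a.
Let phi (x : measurableTypeR R) : measurableTypeR R := a * x + b.

Lemma measurable_affine_line : measurable_fun [set: measurableTypeR R] phi.
Proof. by apply: measurable_funD => //; exact: measurable_funM. Qed.

(** The rescaled pushforward agrees with Lebesgue measure on half-open intervals, which determine
    it. *)
Lemma lebesgue_measure_affine (A : set R) : measurable A ->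
  mu [set x | A (a * x + b)] = (a^-1%:E * mu A)%E.
Proof.
move=> mA; pose k : {nonneg R} := NngNum (ltW a0).
have mphi := measurable_affine_line.
suff -> : mu A = pushforward (mscale k mu) phi A.
  by rewrite /pushforward /mscale /= muleA -EFinM mulVf ?gt_eqF// mul1e.
apply/lebesgue_measure_unique => //= _ [[c d] _ <-].
rewrite /pushforward /mscale /= (_ : _ @^-1` _ = `](c - b) / a, (d - b) / a]%classic).
  rewrite !lebesgue_measure_itv /= !lte_fin ltr_pM2r ?invr_gt0// ltrD2r.
  case: ifP => _; last by rewrite mule0.
  rewrite -!EFinB -EFinM; congr EFin.
  by field; rewrite gt_eqF.
apply/seteqP; split => x /=; rewrite /phi !in_itv /= ler_pdivlMr// ltr_pdivrMr//.
  by rewrite ltrBlDr lerBrDr [x * a]mulrC.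
by rewrite ltrBlDr lerBrDr [x * a]mulrC.
Qed.

Lemma integral_affine_line (f : measurableTypeR R -> \bar R) :
  measurable_fun [set: measurableTypeR R] f -> (forall x, 0 <= f x)%E ->
  (\int[mu]_x f (a * x + b)%R = a^-1%:E * \int[mu]_x f x)%E.
Proof.
move=> mf f0; have k0 : 0 <= a^-1 by rewrite invr_ge0 ltW.
rewrite -[RHS](@ge0_integral_mscale _ _ _ mu setT _ (NngNum k0))//.
rewrite -[LHS](@ge0_integral_pushforward _ _ _ _ _ phi measurable_affine_line mu setT f)//.
apply: eq_measure_integral => [|? A mA _]; first exact: measurable_affine_line.
by rewrite /= /mscale/= -lebesgue_measure_affine.
Qed.

End affine_line.

(** By slicing, one factor [a^-1] per coordinate. Only homotheties and translations split this way;
    reflections are left to [vol_isometry]. *)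
Lemma vol_affine d (a : R) (b : 'rV[R]_d) (A : set 'rV[R]_d) :
  0 < a -> measurable A ->
  vol [set v | A (a *: v + b)] = ((a ^- d)%:E * vol A)%E.
Proof.
move=> a0; elim: d b A => [b A mA|d IH b A mA].
  rewrite invr1 mul1e; congr vol; apply/seteqP.
  by split => v /= ; rewrite (_ : a *: v + b = v)//; apply/rowP; case.
rewrite !vol_slice//; last first.
  by apply: measurable_preimage => //; apply: measurable_rowD => //; apply: measurable_rowZ.
transitivity (\int[mu]_h ((a ^- d)%:E * vol [set w | A (rcons0 (a * h + b 0 0)%R w)]))%E.
  apply: eq_integral => h _; rewrite -(IH (rtail b)); last exact: measurable_slice.
  congr vol; apply/seteqP.
  have E w : a *: rcons0 h w + b = rcons0 (a * h + b 0 0) (a *: w + rtail b).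
    apply/rowP => i; case: (unliftP ord0 i) => [j ->|->].
      by rewrite !mxE liftK !mxE.
    by rewrite !mxE unlift_none.
  by split => w /=; rewrite E.
have mA' := measurable_vol_slice mA.
rewrite ge0_integralZl//; first last.
- by rewrite lee_fin invr_ge0 exprn_ge0// ltW.
- apply: (@measurableT_comp _ _ _ _ _ _ (fun h => vol [set w | A (rcons0 h w)])) => //.
  exact: measurable_affine_line.
rewrite (integral_affine_line (b 0 0) a0 mA')// muleA -EFinM.
by rewrite exprS invfM mulrC.
Qed.

Lemma vol_translate d (b : 'rV[R]_d) (A : set 'rV[R]_d) : measurable A ->
  vol [set v | A (v + b)] = vol A.
Proof.
move=> mA; have := @vol_affine d 1 b A ltr01 mA.
rewrite expr1n invr1 mul1e => <-; congr vol.
by apply/seteqP; split => v /=; rewrite scale1r.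
Qed.
End vol_measure.

(** * Euclidean geometry and volumes *)

Section euclid.
Context (R : realType) (d : nat).
Implicit Types (u v w : 'rV[R]_d) (a r : R).

Lemma innerC u v : inner u v = inner v u.
Proof. by rewrite /inner; apply: eq_bigr => i _; rewrite mulrC. Qed.

Lemma innerDl u v w : inner (u + v) w = inner u w + inner v w.
Proof. by rewrite /inner -big_split; apply: eq_bigr => i _; rewrite !mxE mulrDl. Qed.

Lemma innerZl a u v : inner (a *: u) v = a * inner u v.
Proof. by rewrite /inner mulr_sumr; apply: eq_bigr => i _; rewrite !mxE mulrA. Qed.

Lemma innerDr u v w : inner w (u + v) = inner w u + inner w v.
Proof. by rewrite innerC innerDl !(innerC w). Qed.

Lemma innerZr a u v : inner u (a *: v) = a * inner u v.
Proof. by rewrite innerC innerZl innerC. Qed.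

Lemma innerNl u v : inner (- u) v = - inner u v.
Proof. by rewrite -scaleN1r innerZl mulN1r. Qed.

Lemma innerNr u v : inner u (- v) = - inner u v.
Proof. by rewrite innerC innerNl innerC. Qed.

Lemma inner0l v : inner 0 v = 0.
Proof. by rewrite -(scale0r (0 : 'rV_d)) innerZl mul0r. Qed.

Lemma inner_ge0 u : 0 <= inner u u.
Proof. by apply: sumr_ge0 => i _; rewrite -expr2 sqr_ge0. Qed.

Lemma inner_eq0 u : inner u u = 0 -> u = 0.
Proof.
move=> /eqP; rewrite /inner psumr_eq0; last by move=> i _; rewrite -expr2 sqr_ge0.
move=> /allP h; apply/rowP => i; rewrite mxE; apply/eqP.
by have := h i (mem_index_enum i); rewrite mulf_eq0 orbb.
Qed.

Lemma enorm_ge0 u : 0 <= enorm u. Proof. exact: sqrtr_ge0. Qed.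

Lemma enorm_sqr u : enorm u ^+ 2 = inner u u.
Proof. by rewrite /enorm sqr_sqrtr// inner_ge0. Qed.

Lemma enorm0 : enorm (0 : 'rV[R]_d) = 0.
Proof. by rewrite /enorm inner0l sqrtr0. Qed.

Lemma enorm_eq0 u : enorm u = 0 -> u = 0.
Proof. by move=> u0; apply: inner_eq0; rewrite -enorm_sqr u0 expr0n. Qed.

Lemma enormZ a u : enorm (a *: u) = `|a| * enorm u.
Proof.
by rewrite /enorm innerZl innerZr mulrA -expr2 sqrtrM ?sqr_ge0// sqrtr_sqr.
Qed.

Lemma enormN u : enorm (- u) = enorm u.
Proof. by rewrite -scaleN1r enormZ normrN normr1 mul1r. Qed.

Lemma edistC u v : enorm (u - v) = enorm (v - u).
Proof. by rewrite -enormN opprB. Qed.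

Lemma inner_le_enorm u v : inner u v <= enorm u * enorm v.
Proof.
have [u0|u0] := eqVneq (enorm u) 0.
  by rewrite u0 mul0r (enorm_eq0 u0) inner0l.
have [v0|v0] := eqVneq (enorm v) 0.
  by rewrite v0 mulr0 (enorm_eq0 v0) innerC inner0l.
have up : 0 < enorm u by rewrite lt0r u0 enorm_ge0.
have vp : 0 < enorm v by rewrite lt0r v0 enorm_ge0.
have := inner_ge0 (enorm v *: u - enorm u *: v).
rewrite innerDl !innerDr !innerNl !innerNr !innerZl !innerZr.
rewrite -!enorm_sqr (innerC v u) => h.
have : 0 <= 2 * (enorm u * enorm v) * (enorm u * enorm v - inner u v) by lra.
by rewrite pmulr_rge0 ?subr_ge0// !mulr_gt0.
Qed.

Lemma enormD u v : enorm (u + v) <= enorm u + enorm v.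
Proof.
rewrite -(@ler_pXn2r _ 2)// ?nnegrE ?addr_ge0 ?enorm_ge0//.
rewrite enorm_sqr innerDl !innerDr (innerC v u) -!enorm_sqr.
have := inner_le_enorm u v; nra.
Qed.

Lemma coord_le_enorm u i : `|u 0 i| <= enorm u.
Proof.
rewrite -sqrtr_sqr /enorm ler_wsqrtr// /inner (bigD1 i)//= -expr2 lerDl.
by apply: sumr_ge0 => j _; rewrite -expr2 sqr_ge0.
Qed.

Lemma enorm_le_coord u r : 0 <= r -> (forall i, `|u 0 i| <= r) ->
  enorm u <= d%:R * r.
Proof.
move=> r0 ur; rewrite -(@ler_pXn2r _ 2)// ?nnegrE ?mulr_ge0 ?enorm_ge0//.
rewrite enorm_sqr /inner (@le_trans _ _ (\sum_(i < d) r ^+ 2))//.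
  apply: ler_sum => i _; rewrite -expr2 -real_normK ?num_real//.
  by rewrite ler_pXn2r// nnegrE.
rewrite sumr_const card_ord -[leLHS]mulr_natl exprMn ler_wpM2r ?sqr_ge0//.
by rewrite -natrX ler_nat -{1}(expn1 d); case: (d) => // n; rewrite leq_pexp2l.
Qed.

Lemma sphere_bound u v : enorm u = 1 -> enorm v = 1 -> -1 <= inner u v <= 1.
Proof.
move=> u1 v1; have := inner_le_enorm u v; have := inner_le_enorm (- u) v.
by rewrite innerNl enormN u1 v1 mulr1 lerNl => -> ->.
Qed.

Lemma edist_sqr u v :
  enorm (u - v) ^+ 2 = enorm u ^+ 2 + enorm v ^+ 2 - 2 * inner u v.
Proof.
by rewrite !enorm_sqr innerDl !innerDr !innerNl !innerNr (innerC v u); ring.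
Qed.

End euclid.

Section averaging.
Context d (T : measurableType d) (R : realType).
Variable mu : {measure set T -> \bar R}.

(* Pigeonhole: integrate the sum of the indicators over [B]. *)
Lemma exists_few_indic (I : finType) (A : I -> set T) (B : set T) (k : R) :
  0 <= k -> measurable B -> (forall i, measurable (A i)) ->
  (0 < mu B < +oo)%E -> (\sum_i mu (A i `&` B) <= k%:E * mu B)%E ->
  exists2 v, B v & \sum_i \1_(A i) v <= k.
Proof.
move=> k0 mB mA /andP[B0 Boo] h; apply: contrapT => /forall2NP hn.
have {}hn v : B v -> k < \sum_i \1_(A i) v.
  by move=> Bv; have [//|/negP] := hn v; rewrite -ltNge.
(* The sum counts indices, so exceeding [k] means reaching the next integer [m]. This uniform gap
   survives integration, which a pointwise strict inequality would not directly. *)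
pose m : R := (Num.truncn k).+1%:R.
have hm v : B v -> m <= \sum_i \1_(A i) v.
  move=> /hn; have -> : \sum_i \1_(A i) v = (\sum_i (v \in A i : nat))%N%:R :> R.
    by rewrite natr_sum; apply: eq_bigr => i _; rewrite indicE.
  by rewrite ler_nat -truncn_lt_nat.
have : (m%:E * mu B <= k%:E * mu B)%E.
  apply: le_trans h.
  rewrite -integral_cst//.
  under eq_bigr do rewrite -integral_indic//.
  rewrite -ge0_integral_sum//; last by move=> i; apply/measurable_EFinP.
  apply: ge0_le_integral => //.
  - by move=> x _; rewrite lee_fin ler0n.
  - by apply: emeasurable_sum => i; apply/measurable_EFinP.
  - by move=> x Bx; rewrite sumEFin lee_fin; exact: hm.
rewrite lee_pmul2r// ?lee_fin; last by rewrite ge0_fin_numE// ltW.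
by apply/negP; rewrite -ltNge truncnS_gt.
Qed.

End averaging.

Section vol_sets.
Context (R : realType).

(** Half-open, so that the lattice translates of a cube partition the space. *)
Definition cube d (s : R) : set 'rV[R]_d := [set v | forall i, 0 <= v 0 i < s].
Arguments cube : clear implicits.

Lemma measurable_cube d s : measurable (cube d s).
Proof.
rewrite (_ : cube d s = \bigcap_(i in [set: 'I_d]) ([set v | 0 <= v 0 i] `&` [set v | v 0 i < s])).
  apply: fin_bigcap_measurable => // i _; apply: measurableI.
    by apply: measurable_le => //; exact: measurable_coord.
  by apply: measurable_lt => //; exact: measurable_coord.
apply/seteqP; split => v /= h.
  by move=> i _; have /andP[] := h i.
by move=> i; have [/= -> ->] := h i I.
Qed.

Local Notation mu := (@lebesgue_measure R).

Lemma vol_cube d s : 0 <= s -> vol (cube d s) = (s ^+ d)%:E.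
Proof.
move=> s0; elim: d => [|d IH].
  rewrite /vol /= expr0 (_ : mkset _ = setT) ?diracT//.
  by apply/seteqP; split=> // t _ [].
rewrite vol_slice; last exact: measurable_cube.
transitivity (\int[mu]_(h in `[0%R, s[) (s ^+ d)%:E)%E.
  rewrite [RHS]integral_mkcond; apply: eq_integral => h _; rewrite patchE.
  have E w : cube d.+1 s (rcons0 h w) <-> 0 <= h < s /\ cube d s w.
    split=> [H|[H1 H2] i]; last first.
      by case: (unliftP ord0 i) => [j ->|->]; rewrite ?rcons0_lift ?rcons0_0.
    split; first by have := H ord0; rewrite rcons0_0.
    by move=> i; have := H (lift ord0 i); rewrite rcons0_lift.
  case: ifPn => [|]; rewrite ?inE ?notin_setE /= in_itv /= => hs.
    by rewrite -IH; congr vol; apply/seteqP; split => w /=; rewrite E; [case|].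
  transitivity (@vol R d set0); last exact: measure0.
  by congr vol; apply/seteqP; split => w //=; rewrite E => -[/hs].
rewrite integral_cst//= lebesgue_measure_itv /= lte_fin.
rewrite exprS mulrC; case: ltP => [_|s0']; first by rewrite -EFinB subr0.
by rewrite mule0 (@le_anti _ _ s 0) ?mulr0// s0 s0'.
Qed.

Definition kappa d : R := fine (vol (eball 0 1 : set 'rV[R]_d)).

Lemma vol_eball_mul d (c : 'rV[R]_d) r : 0 < r ->
  vol (eball c r) = ((r ^+ d)%:E * vol (eball 0 1 : set 'rV[R]_d))%E.
Proof.
move=> r0; have ri : 0 < r^-1 by rewrite invr_gt0.
have := vol_affine (- (r^-1 *: c)) ri (@measurable_eball R d 0 1).
rewrite exprVn invrK => <-; congr vol; apply/seteqP.
have E v : (enorm (v - c) <= r) = (enorm (r^-1 *: v - r^-1 *: c - 0) <= 1).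
  by rewrite subr0 -scalerBr enormZ gtr0_norm// mulrC ler_pdivrMr// mul1r.
by split => v /=; rewrite /eball /= E.
Qed.

Lemma vol_eball01_lty d : (vol (eball 0 1 : set 'rV[R]_d) < +oo)%E.
Proof.
have mC := @measurable_cube d 3.
apply: (@le_lt_trans _ _ (vol [set v : 'rV_d | cube d 3 (v + const_mx 1)])).
  apply: le_measure; rewrite ?inE.
  - exact: measurable_eball.
  - by apply: measurable_preimage => //; apply: measurable_rowD.
  - move=> v /=; rewrite /eball/= subr0 => v1 i; rewrite !mxE.
    have := le_trans (coord_le_enorm v i) v1; rewrite ler_norml; lra.
by rewrite vol_translate// vol_cube// ltry.
Qed.

(** A ball containing the unit cube has positive volume; scale it down. The radius [d.+1] instead of
    [d] stays positive in dimension 0. *)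
Lemma kappa_gt0 d : 0 < kappa d.
Proof.
have : (1 <= vol (eball 0 d.+1%:R : set 'rV[R]_d))%E.
  have -> : 1%E = vol (cube d (1 : R)) by rewrite vol_cube// expr1n.
  apply: le_measure; rewrite ?inE.
  - exact: measurable_cube.
  - exact: measurable_eball.
  - move=> v h; rewrite /eball /mkset subr0.
    apply: (@le_trans _ _ (d%:R * 1)); last by rewrite mulr1 ler_nat ltnW.
    by apply: enorm_le_coord => // i; have := h i; rewrite ler_norml; lra.
rewrite vol_eball_mul// /kappa.
have := vol_eball01_lty d; have : (0 <= vol (eball 0 1 : set 'rV[R]_d))%E by [].
case: (vol _) => // x; rewrite lee_fin le_eqVlt => /predU1P[<- _|//].
by rewrite mule0 lee_fin ler10.
Qed.

Lemma vol_eball d (c : 'rV[R]_d) r : 0 < r ->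
  vol (eball c r) = (r ^+ d * kappa d)%:E.
Proof.
move=> r0; rewrite vol_eball_mul// /kappa EFinM fineK//.
by rewrite ge0_fin_numE ?vol_eball01_lty.
Qed.

Lemma vol_bounded_lty d (A : set 'rV[R]_d) r : measurable A ->
  (forall v, A v -> enorm v <= r) -> (vol A < +oo)%E.
Proof.
move=> mA Ar; apply: (@le_lt_trans _ _ (vol (eball (0 : 'rV_d) (`|r| + 1)))).
  apply: le_measure; rewrite ?inE//; first exact: measurable_eball.
  move=> v /Ar; rewrite /eball /= subr0 => h.
  by rewrite (le_trans h)// (le_trans (ler_norm r))// lerDl.
by rewrite vol_eball ?ltry// ltr_pwDr.
Qed.

Lemma measurable_row_set1 d (v : 'rV[R]_d) : measurable [set v].
Proof.
rewrite (_ : [set v] = eball v 0); first exact: measurable_eball.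
apply/seteqP; split => x; rewrite /eball /=; first by move=> ->; rewrite subrr enorm0.
move=> h; apply/eqP; rewrite -subr_eq0; apply/eqP/enorm_eq0.
by apply/eqP; rewrite eq_le h enorm_ge0.
Qed.

(** The dimension is a successor because a point has volume 1 in dimension 0. It serves to discard
    the apex of cones. *)
Lemma vol_set1 d (v : 'rV[R]_d.+1) : vol [set v] = 0%E.
Proof.
have mv := measurable_row_set1 v.
have h e : 0 < e -> e <= 1 -> (vol [set v] <= (e * kappa d.+1)%:E)%E.
  move=> e0 e1; apply: (@le_trans _ _ (vol (eball v e))).
    apply: le_measure; rewrite ?inE//; first exact: measurable_eball.
    by move=> x ->; rewrite /eball/= subrr enorm0 ltW.
  rewrite vol_eball// lee_fin ler_wpM2r ?(ltW (kappa_gt0 _))//.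
  by rewrite exprS ler_piMr ?(ltW e0)// exprn_ile1// ltW.
apply/eqP; rewrite eq_le measure_ge0 andbT.
apply/lee_addgt0Pr => e e0; rewrite add0e.
have k0 := kappa_gt0 d.+1.
apply: (le_trans (h (Num.min 1 (e / kappa d.+1)) _ _)).
- by rewrite lt_min ltr01 divr_gt0.
- by rewrite ge_min lexx.
- by rewrite lee_fin -ler_pdivlMr// ge_min lexx orbT.
Qed.

End vol_sets.
Arguments cube {R} d s.
Arguments kappa : clear implicits.

(* Conversion tests that unfold [vol] do not terminate in practice. *)
Opaque vol.

Lemma set_and_true T (P : Prop) (Q : set T) : P -> [set y | P /\ Q y] = Q.
Proof. by move=> p; apply/seteqP; split => [y []|y ?]. Qed.

Lemma set_and_false T (P : Prop) (Q : set T) : ~ P -> [set y | P /\ Q y] = set0.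
Proof. by move=> p; apply/seteqP; split => y // -[]. Qed.

Lemma emulI (R : realDomainType) (a : R) (x y : \bar R) : 0 < a ->
  (a%:E * x = a%:E * y)%E -> x = y.
Proof.
move=> a0 /eqP; rewrite eq_le !lee_pmul2l ?lte_fin// => /andP[h1 h2].
by apply/eqP; rewrite eq_le h1 h2.
Qed.

(** * Invariance of the volume under linear isometric involutions *)

Section isometry.
Context (R : realType) (d : nat).
Local Notation V := 'rV[R]_d.

Lemma vol_fubini (S : set (V * V)) : measurable S ->
  (\int[@vol R d]_x vol [set y | S (x, y)] =
   \int[@vol R d]_y vol [set x | S (x, y)])%E.
Proof.
move=> mS; have := indic_fubini_tonelli (@vol R d) (@vol R d) mS.
rewrite indic_fubini_tonelli_FE// indic_fubini_tonelli_GE// => h.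
transitivity (\int[@vol R d]_x (@vol R d \o xsection S) x)%E.
  apply: eq_integral => x _ /=; congr vol; apply/seteqP.
  by split => y /=; rewrite /xsection /= inE.
rewrite h; apply: eq_integral => x _ /=; congr vol; apply/seteqP.
by split => y /=; rewrite /ysection /= inE.
Qed.

Lemma integral_set_cst (P : set V) (F : V -> \bar R) (c : \bar R) :
  measurable P -> (0 <= c)%E -> (forall x, P x -> F x = c) ->
  (forall x, ~ P x -> F x = 0%E) -> (\int[@vol R d]_x F x = c * vol P)%E.
Proof.
move=> mP c0 Fc F0; rewrite -integral_cst// [RHS]integral_mkcond.
apply: eq_integral => x _; rewrite patchE; case: ifPn => [|]; rewrite ?inE ?notin_setE.
  exact: Fc.
exact: F0.
Qed.

Variable H : V -> V.
Hypothesis mH : measurable_fun [set: V] H.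
Hypothesis HD : forall u v, H (u + v) = H u + H v.
Hypothesis HK : forall u, H (H u) = u.
Hypothesis Hn : forall u, enorm (H u) = enorm u.

(* Uniqueness of Haar measure: integrate [[A (H x) /\ |H x - y| <= 1]] over
   [(x, y)] in both orders, using translation invariance only; the unit ball,
   fixed by [H], cancels. *)
Lemma vol_isometry (A : set V) : measurable A -> vol [set v | A (H v)] = vol A.
Proof.
move=> mA; pose B := eball (0 : V) 1.
have mB : measurable B by exact: measurable_eball.
have mHA : measurable [set v | A (H v)] by exact: measurable_preimage.
have B0 : (0 <= vol B)%E by [].
have mf : measurable_fun [set: V * V] (fun p : V * V => H p.1) by exact: measurableT_comp.
have m1 : measurable ([set p : V * V | A (H p.1)] `&` [set p | B (p.2 - H p.1)]).
  apply: measurableI; first exact: measurable_preimage.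
  by apply: measurable_preimage => //; apply: measurable_rowB.
have m2 : measurable ([set p : V * V | B p.1] `&` [set p | A (p.2 + H p.1)]).
  apply: measurableI; first exact: measurable_preimage.
  by apply: measurable_preimage => //; apply: measurable_rowD.
have e1 := vol_fubini m1; have e2 := vol_fubini m2.
have E1 : (\int[@vol R d]_x vol [set y | A (H x) /\ B (y - H x)%R] =
    vol B * vol [set v | A (H v)])%E.
  apply: (@integral_set_cst [set v | A (H v)]
    (fun x => vol [set y | A (H x) /\ B (y - H x)]) (vol B) mHA B0) => x /= Ax.
    by rewrite (set_and_true _ Ax) (vol_translate (- H x) mB).
  by rewrite (set_and_false _ Ax); exact: measure0.
have E2 : (\int[@vol R d]_x vol [set y | B x /\ A (y + H x)%R] = vol B * vol A)%E.
  have A0 : (0 <= vol A)%E by [].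
  rewrite muleC; apply: (@integral_set_cst B
    (fun x => vol [set y | B x /\ A (y + H x)]) (vol A) mB A0) => x /= Bx.
    by rewrite (set_and_true _ Bx) (vol_translate (H x) mA).
  by rewrite (set_and_false _ Bx); exact: measure0.
have E3 : (\int[@vol R d]_y vol [set x | A (H x) /\ B (y - H x)%R] =
    \int[@vol R d]_y vol [set x | B x /\ A (y + H x)%R])%E.
  apply: eq_integral => y _.
  have mBH : measurable [set x | B (y - H x)].
    by apply: (measurable_preimage _ mB); exact: measurable_rowB.
  have mS : measurable [set x | A (H x) /\ B (y - H x)] := measurableI _ _ mHA mBH.
  (* Since [H] is an involution, replacing [x] by [x + H y] turns [H x] into [y + H x], and the
     condition on [y - H x] becomes one on [- H x], that is, on the norm of [x]. *)
  rewrite -(vol_translate (H y) mS); congr vol.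
  have E x : H (x + H y) = y + H x by rewrite HD HK addrC.
  have E' x : B (y - (y + H x)) = B x.
    by rewrite /B /eball /mkset opprD addrA subrr sub0r !subr0 enormN Hn.
  apply: eq_set => x; rewrite -[LHS]/(A (H (x + H y)) /\ B (y - H (x + H y))) E E'.
  by rewrite propeqE; split => -[? ?]; split.
have : (vol B * vol [set v | A (H v)] = vol B * vol A)%E.
  by rewrite -E1 -E2; transitivity (\int[@vol R d]_y vol [set x | B x /\ A (y + H x)%R])%E;
    [rewrite -E3; exact: e1 | exact/esym/e2].
have kB : vol B = (kappa R d)%:E by rewrite (vol_eball (0 : V) ltr01) expr1n mul1r.
move: (vol B) kB => b ->.
exact: emulI (kappa_gt0 R d).
Qed.

End isometry.

(** * Volumes of pyramids *)

Section pyramid.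
Context (R : realType) (d : nat).
Local Notation mu := (@lebesgue_measure R).

(** Apex at the origin, axis along coordinate 0, and base [h *: G] at height [h]. The apex is left
    out so that dividing by the height makes sense. *)
Definition pyramid (h : R) (G : set 'rV[R]_d) : set 'rV[R]_d.+1 :=
  [set v : 'rV[R]_d.+1 | 0 < v 0 0 <= h /\ G ((v 0 0)^-1 *: rtail v)].

Lemma measurable_pyramid h G : measurable G -> measurable (pyramid h G).
Proof.
move=> mG; have m0 := @measurable_coord R d.+1 0.
(* At positive heights the inverse equals the power with exponent [-1], which is measurable on the
   whole line. *)
rewrite (_ : pyramid h G = ([set v : 'rV[R]_d.+1 | 0 < v 0 0] `&` [set v : 'rV[R]_d.+1 | v 0 0 <= h]) `&`
  [set v : 'rV[R]_d.+1 | G (v 0 0 `^ (- 1) *: rtail v)]).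
  apply: measurableI; first apply: measurableI.
  - exact: measurable_lt.
  - exact: measurable_le.
  - apply: (measurable_preimage _ mG).
    apply: (@measurable_rowZ _ _ _ _ (fun v : 'rV[R]_d.+1 => v 0 0 `^ (- 1)) (@rtail R d)).
      exact: (measurableT_comp (@measurable_powR R (- 1)) m0).
    exact: measurable_rtail.
apply/seteqP; split => v; rewrite /pyramid /=.
  by move=> [/andP[v0 ->] Gv]; rewrite powR_inv1// ltW.
by move=> [[v0 ->]]; rewrite powR_inv1 ?v0// ltW.
Qed.

(** The integral of [h ^+ d] over the unit interval, that is [1 / d.+1]; only its positivity is
    used. *)
Definition gam : R := fine (vol (pyramid 1 (cube d 1))).

Lemma vol_pyramid1 G : measurable G ->
  vol (pyramid 1 G) = (vol G * \int[mu]_(h in `]0%R, 1%R]) (h ^+ d)%:E)%E.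
Proof.
move=> mG; rewrite vol_slice; last exact: measurable_pyramid.
have mX (D : set R) : measurable_fun D (fun h : R => (h ^+ d)%:E).
  by apply/measurable_EFinP; apply: measurable_funX.
rewrite -ge0_integralZl//; [|exact: mX|]; last first.
  by move=> x /=; rewrite in_itv /= lee_fin => /andP[x0 _]; rewrite exprn_ge0// ltW.
rewrite [RHS]integral_mkcond; apply: eq_integral => h _; rewrite patchE.
case: ifPn => [|]; rewrite ?inE ?notin_setE /= in_itv /= => hh.
  have /andP[h0 _] := hh; have hi : 0 < h^-1 by rewrite invr_gt0.
  have := vol_affine 0 hi mG; rewrite exprVn invrK muleC => <-.
  congr vol; apply/seteqP.
  by split => w; rewrite /pyramid /= rcons0_0 rcons0K addr0; [case|].
transitivity (@vol R d set0); last exact: measure0.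
congr vol; apply/seteqP; split => w //.
by rewrite /pyramid /= rcons0_0 => -[/hh].
Qed.

Lemma int_expn_itv : 
  (0 < \int[mu]_(h in `]0%R, 1%R]) (h ^+ d)%:E < +oo)%E.
Proof.
have mX (D : set R) : measurable_fun D (fun h : R => (h ^+ d)%:E).
  by apply/measurable_EFinP; apply: measurable_funX.
apply/andP; split; last first.
  apply: (@le_lt_trans _ _ (\int[mu]_(h in `]0%R, 1%R]) (cst 1%:E h))%E).
    apply: ge0_le_integral => //.
    - by move=> x /=; rewrite in_itv /= lee_fin => /andP[x0 _]; rewrite exprn_ge0// ltW.
    - exact: mX.
    - move=> x /=; rewrite in_itv /= => /andP[x0 x1]; rewrite lee_fin.
      by apply: exprn_ile1 => //; exact: ltW.
  by rewrite integral_cst//= mul1e lebesgue_measure_itv /=; case: ifP => _; rewrite -?EFinB ltry.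
apply: (@lt_le_trans _ _ (\int[mu]_(h in `](2^-1)%R, 1%R]) (cst ((2^-1) ^+ d)%:E h))%E).
  rewrite integral_cst//= lebesgue_measure_itv /= lte_fin invf_lt1// ltr1n.
  by rewrite -EFinB -EFinM lte_fin mulr_gt0 ?exprn_gt0//; lra.
apply: (@le_trans _ _ (\int[mu]_(h in `](2^-1)%R, 1%R]) (h ^+ d)%:E)%E).
  apply: ge0_le_integral => //.
  - move=> x /=; rewrite in_itv /= lee_fin => /andP[x0 _].
    by rewrite exprn_ge0// (le_trans _ (ltW x0)).
  - exact: mX.
  - move=> x /=; rewrite in_itv /= lee_fin => /andP[x0 _].
    by rewrite lerXn2r ?nnegrE ?(ltW x0)// (le_trans _ (ltW x0)).
apply: ge0_subset_integral => //.
- exact: mX.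
- by move=> x /=; rewrite in_itv /= lee_fin => /andP[x0 _]; rewrite exprn_ge0// ltW.
- by apply: subset_itvr; rewrite bnd_simp.
Qed.

Lemma gam_gt0 : 0 < gam.
Proof.
rewrite /gam vol_pyramid1; last exact: measurable_cube.
rewrite vol_cube// expr1n mul1e; have := int_expn_itv.
set I := integral _ _ _.
by case: I => [x||] //=; rewrite ?lte_fin// => /andP[].
Qed.

Lemma vol_pyramid h G : 0 < h -> measurable G ->
  vol (pyramid h G) = ((h ^+ d.+1 * gam)%:E * vol G)%E.
Proof.
move=> h0 mG.
have -> : pyramid h G = [set v | pyramid 1 G (h^-1 *: v + 0)].
  have E (v : 'rV[R]_d.+1) : (0 < v 0 0 <= h) = (0 < h^-1 * v 0 0 <= 1).
    by rewrite pmulr_rgt0 ?invr_gt0// mulrC ler_pdivrMr// mul1r.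
  have E' (v : 'rV[R]_d.+1) : (h^-1 * v 0 0)^-1 *: rtail (h^-1 *: v) = (v 0 0)^-1 *: rtail v.
    apply/rowP => i; rewrite !mxE invfM invrK; set a := v 0 _.
    by rewrite mulrACA mulfV ?gt_eqF// mul1r.
  by apply/seteqP; split => v /=; rewrite /pyramid /= addr0 !mxE E E'.
rewrite vol_affine ?invr_gt0//; last exact: measurable_pyramid.
rewrite exprVn invrK EFinM -muleA; congr (_ * _)%E.
rewrite vol_pyramid1// muleC /gam vol_pyramid1; last exact: measurable_cube.
rewrite vol_cube// expr1n mul1e fineK//.
by have /andP[g0 goo] := int_expn_itv; rewrite ge0_fin_numE// ltW.
Qed.

End pyramid.

(** * Coverings of the Euclidean space *)

Section cells.
Context (R : realType) (d : nat) (A : R).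
Hypothesis A0 : 0 < A.
Local Notation V := 'rV[R]_d.

Definition latt (z : 'rV[int]_d) : V := \row_i (A * (z 0 i)%:~R).

Lemma lattD z w : latt (z + w) = latt z + latt w.
Proof. by apply/rowP => i; rewrite !mxE intrD mulrDr. Qed.

Lemma lattB z w : latt (z - w) = latt z - latt w.
Proof. by apply/rowP => i; rewrite !mxE intrD rmorphN mulrDr mulrN. Qed.

Definition cell (z : 'rV[int]_d) : set V := [set v | cube d A (v - latt z)].

Lemma measurable_cell z : measurable (cell z).
Proof.
apply: (measurable_preimage _ (@measurable_cube R d A)).
exact: measurable_rowB.
Qed.

Lemma vol_cell z : vol (cell z) = (A ^+ d)%:E.
Proof.
by rewrite [LHS](vol_translate (- latt z) (@measurable_cube R d A)) vol_cube// ltW.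
Qed.

Lemma cellP z v : cell z v <-> z = \row_i Num.floor (v 0 i / A).
Proof.
have E (w : 'rV[int]_d) i : (0 <= (v - latt w) 0 i < A) = (Num.floor (v 0 i / A) == w 0 i).
  rewrite floor_eq !mxE ler_pdivlMr// ltr_pdivrMr// intrD mulrDl mul1r.
  by rewrite subr_ge0 ltrBlDl ![A * _]mulrC.
split => [h|-> i]; first by apply/rowP => i; rewrite mxE; apply/esym/eqP; rewrite -E.
by rewrite E mxE.
Qed.

Lemma cell_ex v : exists z, cell z v.
Proof. by eexists; apply/cellP; reflexivity. Qed.

Lemma cell_inj z w v : cell z v -> cell w v -> z = w.
Proof. by move=> /cellP -> /cellP ->. Qed.

Lemma trivIset_cell S (G : set V) : trivIset S (fun z => G `&` cell z).
Proof.
by move=> z w _ _ [v [[_ zv] [_ wv]]]; exact: cell_inj zv wv.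
Qed.

Lemma cube_enorm v : cube d A v -> enorm v <= d%:R * A.
Proof.
move=> h; apply: enorm_le_coord; first exact: ltW.
by move=> i; have /andP[h1 /ltW h2] := h i; rewrite ger0_norm.
Qed.

Lemma cell_dist z v w : cell z v -> cell z w -> enorm (v - w) <= 2 * (d%:R * A).
Proof.
move=> /cube_enorm h1 /cube_enorm h2.
have -> : v - w = (v - latt z) - (w - latt z) by rewrite opprB addrA subrK.
by rewrite (le_trans (enormD _ _))// enormN mulr2n mulrDl mul1r lerD.
Qed.

Definition touching (r : R) : set 'rV[int]_d :=
  [set z | exists2 v, cell z v & enorm v <= r].

Lemma finite_touching r : finite_set (touching r).
Proof.
(* A coordinate of [z] is the floor of a number of modulus at most [(|r| + 1) / A], so its own
   modulus is at most one more; adding [K] puts it between 0 and [2 * K]. *)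
pose K := Num.truncn ((`|r| + 1) / A + 1).
pose g (k : {ffun 'I_d -> 'I_(K.*2.+1)}) : 'rV[int]_d := \row_i ((k i)%:Z - K%:Z).
apply: (@sub_finite_set _ _ (g @` setT)); last first.
  by apply: finite_image; exact: finite_finset.
move=> z [v zv vr].
have hz (i : 'I_d) : (absz (z 0 i)%R <= K)%N.
  have /cellP -> := zv; rewrite mxE.
  have h1 := floor_itv (v 0 i / A).
  have h2 : `|v 0 i / A| <= (`|r| + 1) / A.
    rewrite normrM (gtr0_norm (x := A^-1)) ?invr_gt0// ler_pM2r ?invr_gt0//.
    apply: le_trans (coord_le_enorm v i) _; apply: le_trans vr _.
    by rewrite (le_trans (ler_norm r))// lerDl.
  rewrite truncn_ge_nat; last by rewrite addr_ge0// divr_ge0 ?addr_ge0// ltW.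
  move: h1; rewrite natr_absz intr_norm intrD => /andP[h3 h4].
  by move: h2; rewrite !ler_norml; lra.
exists [ffun i => inord (absz (z 0 i + K%:Z))] => //.
apply/rowP => i; rewrite mxE ffunE inordK; have := hz i; lia.
Qed.

End cells.

Section periodic_covering.
Context (R : realType) (d : nat) (A : R) (I : finType) (c : I -> 'rV[R]_d).
Hypotheses (d0 : (0 < d)%N) (A0 : 0 < A).
Hypothesis cube_cover : cube d A `<=` \bigcup_k eball (c k) 1.
Local Notation V := 'rV[R]_d.

(** A set and not a family: translates that coincide count once, as the injective enumeration in
    [unit_ball_covering] demands. *)
Definition centers : set V := [set x | exists k z, x = c k + latt A z].

(** The translates of one center along the diagonal are pairwise distinct because there is at least
    one coordinate; conversely the centers are an image of a countable type. *)
Lemma centers_infinite_countable : exists x : nat -> V, set_bij setT centers x.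
Proof.
suff : ([set: nat] #= centers)%card by move/card_set_bijP.
apply: Cantor_Bernstein.
  have [k _ _] : (\bigcup_k eball (c k) 1) 0.
    by apply: cube_cover => i; rewrite mxE lexx A0.
  apply/pcard_leP/injfunPex; exists (fun n => c k + latt A (const_mx n%:Z)).
    by move=> n _; exists k, (const_mx n%:Z).
  move=> m n _ _ /addrI /rowP/(_ (Ordinal d0)); rewrite !mxE.
  by move/(mulfI (lt0r_neq0 A0))/intr_inj => -[].
have -> : centers = (fun p => c p.1 + latt A p.2) @` [set: I * 'rV[int]_d].
  apply/seteqP; split => [x [k [z ->]]|x [[k z] _ <-]]; first by exists (k, z).
  by exists k, z.
apply: (card_le_trans (card_image_le _ _)).
exact: countableP.
Qed.

Lemma centers_cover : \bigcup_(x in centers) eball x 1 = setT.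
Proof.
apply/seteqP; split => // v _; have [z zv] := cell_ex A0 v.
have [k _ kv] := cube_cover zv; exists (c k + latt A z); first by exists k, z.
by move: kv; rewrite /eball /= opprD addrA addrAC.
Qed.

Definition mass (B : set V) : \bar R := (\esum_(x in centers) vol (eball x 1 `&` B))%E.

Lemma measurable_eballI (x : V) (B : set V) : measurable B -> measurable (eball x 1 `&` B).
Proof. by move=> mB; apply: measurableI => //; exact: measurable_eball. Qed.

Lemma mass_le (B C : set V) : measurable B -> measurable C -> B `<=` C ->
  (mass B <= mass C)%E.
Proof.
move=> mB mC BC; apply: le_esum => x _.
apply: le_measure; rewrite ?inE; [exact: measurable_eballI..|].
by apply: setIS.
Qed.

Lemma vol_eball_cell (x : V) (z w : 'rV[int]_d) :
  vol (eball x 1 `&` cell A z) = vol (eball (x - latt A (z - w)) 1 `&` cell A w).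
Proof.
have mB := measurable_eballI (x - latt A (z - w)) (measurable_cell A w).
rewrite -(vol_translate (- latt A (z - w)) mB); congr vol.
apply: eq_set => v; rewrite /setI /cell /eball /mkset.
have -> : v - latt A (z - w) - (x - latt A (z - w)) = v - x by rewrite opprB addrA subrK.
have -> // : v - latt A (z - w) - latt A w = v - latt A z.
by rewrite lattB opprB -addrA [_ - _ - _]addrAC subrr sub0r.
Qed.

Lemma mass_cell z : mass (cell A z) = mass (cell A 0).
Proof.
rewrite {1}/mass; under eq_esum do rewrite (vol_eball_cell _ z 0) subr0.
rewrite -(@reindex_esum _ _ _ centers centers (fun x => x - latt A z)
  (fun x => vol (eball x 1 `&` cell A 0)))//; split.
- by move=> _ [k [w ->]]; exists k, (w - z); rewrite lattB addrA.
- by move=> x y _ _ /addIr.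
- move=> _ [k [w ->]]; exists (c k + latt A (w + z)); first by exists k, (w + z).
  by rewrite lattD addrA addrK.
Qed.

Lemma vol_cells (S : set 'rV[int]_d) (G : set V) : finite_set S -> measurable G ->
  vol (G `&` \bigcup_(z in S) cell A z) = (\sum_(z <- fset_set S) vol (G `&` cell A z))%E.
Proof.
move=> finS mG; rewrite setI_bigcupr measure_fin_bigcup//.
- by rewrite fsbig_finite.
- exact: trivIset_cell.
- by move=> z _; apply: measurableI => //; exact: measurable_cell.
Qed.

Lemma mass_cells (S : set 'rV[int]_d) : finite_set S ->
  mass (\bigcup_(z in S) cell A z) = (\sum_(z <- fset_set S) mass (cell A z))%E.
Proof.
move=> finS; rewrite /mass -esum_sum//.
by apply: eq_esum => x _; rewrite vol_cells//; exact: measurable_eball.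
Qed.

(** The part of the ball around [c k + latt A z] in cell 0 is a translate of the part of the ball
    around [c k] in cell [- z]. Different cells are disjoint, so the centers attached to one [k]
    contribute at most one unit ball. It is only an inequality: [kz] attaches coinciding centers to
    a single [k]. *)
Lemma mass_cell0_le : (mass (cell A 0) <= (#|I|%:R * kappa R d)%:E)%E.
Proof.
apply: ge_ereal_sup => _ [E [finE Esub] <-].
have /choice[kz kzE] : forall x, exists kz : I * 'rV[int]_d,
    centers x -> x = c kz.1 + latt A kz.2.
  move=> x; have [[k [z ->]]|nx] := pselect (centers x); first by exists (k, z).
  have [k _ _] : (\bigcup_k eball (c k) 1) 0.
    by apply: cube_cover => i; rewrite mxE lexx A0.
  by exists (k, 0).
rewrite fsbig_finite//= (partition_big (fun x => (kz x).1) xpredT)//=.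
have -> : (#|I|%:R * kappa R d)%:E = (\sum_(k : I) (kappa R d)%:E)%E.
  by rewrite sumEFin sumr_const mulr_natl.
apply: lee_sum => k _.
have -> : kappa R d = 1 ^+ d * kappa R d by rewrite expr1n mul1r.
rewrite -(vol_eball (c k) ltr01).
pose T := [set x | E x /\ (kz x).1 = k].
have TE x : T x -> x = c k + latt A (kz x).2.
  by move=> [/Esub/kzE h <-].
have finT : finite_set T by apply: sub_finite_set finE => x [].
apply: (@le_trans _ _ (vol (eball (c k) 1 `&` \bigcup_(z in [set - (kz x).2 | x in T]) cell A z))).
  rewrite vol_cells; [|exact: finite_image|exact: measurable_eball].
  rewrite -fsbig_finite; last exact: finite_image.
  rewrite (@reindex_fsbig _ _ _ _ _ (fun x => - (kz x).2) T); last first.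
    apply: inj_bij => x y; rewrite !inE => Tx Ty /oppr_inj h.
    by rewrite (TE x)// (TE y)// h.
  rewrite fsbig_finite//=.
  rewrite -big_filter.
  have P : perm_eq [seq x <- fset_set E | (kz x).1 == k] (fset_set T).
    apply: uniq_perm => [||x]; rewrite ?filter_uniq ?fset_uniq//.
    rewrite mem_filter; apply/andP/idP; rewrite !in_fset_set// !inE.
      by move=> [/eqP ? ?]; split.
    by move=> [? /eqP ?]; split.
  rewrite (perm_big _ P) /= big_seq [leRHS]big_seq; apply: lee_sum => x.
  rewrite in_fset_set// inE => Tx.
  rewrite {1}(TE x Tx) (vol_eball_cell _ 0 (- (kz x).2)) opprK add0r addrK.
  by [].
apply: le_measure; rewrite ?inE; last exact: subIsetl.
- apply: measurable_eballI; apply: fin_bigcup_measurable; first exact: finite_image.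
  by move=> z _; exact: measurable_cell.
- exact: measurable_eball.
Qed.

(** The density of the periodic covering: mass per volume of one period. By [mass_cell0_le], [fine]
    loses nothing. *)
Let q := fine (mass (cell A 0)) / A ^+ d.

Let q_ge0 : 0 <= q.
Proof.
apply: divr_ge0; last by rewrite exprn_ge0// ltW.
by apply: fine_ge0; apply: esum_ge0.
Qed.

Let mass_cell0E : mass (cell A 0) = (q * A ^+ d)%:E.
Proof.
rewrite /q divfK ?gt_eqF ?exprn_gt0// fineK// ge0_fin_numE; last exact: esum_ge0.
by apply: le_lt_trans mass_cell0_le _; rewrite ltry.
Qed.

Lemma mass_cellsE (S : set 'rV[int]_d) : finite_set S ->
  mass (\bigcup_(z in S) cell A z) = (q%:E * vol (\bigcup_(z in S) cell A z))%E.
Proof.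
move=> finS; rewrite mass_cells// -[X in vol X]setTI vol_cells//.
under eq_bigr do rewrite mass_cell mass_cell0E.
under [in RHS]eq_bigr do rewrite setTI vol_cell//.
by rewrite !sumEFin -EFinM mulr_sumr.
Qed.

Let D := 2 * (d%:R * A).

Let D_ge0 : 0 <= D.
Proof. by rewrite mulr_ge0// mulr_ge0// ltW. Qed.

(** On unions of whole cells the mass is exactly [q] times the volume. A block lies between the
    balls of radii [r] and [r + D], since [D] bounds the diameter of a cell. *)
Let block r := \bigcup_(z in touching A r) cell A z : set V.

Let measurable_block r : measurable (block r).
Proof.
apply: fin_bigcup_measurable; first exact: finite_touching.
by move=> z _; exact: measurable_cell.
Qed.

Let sub_block r : eball 0 r `<=` block r.
Proof.
move=> v; rewrite /eball /= subr0 => vr; have [z zv] := cell_ex A0 v.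
by exists z => //; exists v.
Qed.

Let block_sub r : block r `<=` eball 0 (r + D).
Proof.
move=> v [z [w zw wr] zv]; rewrite /eball /= subr0.
rewrite -(subrK w v) (le_trans (enormD _ _))// addrC lerD//.
exact: cell_dist zv zw.
Qed.

Lemma mass_eball_ub r : 0 < r ->
  (mass (eball 0 r) <= (q * ((r + D) ^+ d * kappa R d))%:E)%E.
Proof.
move=> r0; apply: (@le_trans _ _ (mass (block r))).
  by apply: mass_le => //; exact: measurable_eball.
rewrite mass_cellsE; last exact: finite_touching.
rewrite [X in (_ <= X)%E]EFinM -(vol_eball (0 : V)); last by rewrite ltr_pwDl.
apply: lee_wpmul2l; first by rewrite lee_fin.
by apply: le_measure; rewrite ?inE; [exact: measurable_block|exact: measurable_eball|exact: block_sub].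
Qed.

Lemma mass_eball_lb r : D < r ->
  ((q * ((r - D) ^+ d * kappa R d))%:E <= mass (eball 0 r))%E.
Proof.
move=> r0; apply: (@le_trans _ _ (mass (block (r - D)))); last first.
  apply: mass_le => //; first exact: measurable_eball.
  by apply: subset_trans (@block_sub _) _; rewrite subrK.
rewrite mass_cellsE; last exact: finite_touching.
rewrite [X in (X <= _)%E]EFinM -(vol_eball (0 : V)); last by rewrite subr_gt0.
apply: lee_wpmul2l; first by rewrite lee_fin.
by apply: le_measure; rewrite ?inE; [exact: measurable_eball|exact: measurable_block|exact: sub_block].
Qed.

Lemma cvg_pow_shift (a : R) : ((r + a) / r) ^+ d @[r --> +oo%R] --> (1 : R).
Proof.
rewrite -(expr1n R d).
apply: (@continuous_cvg _ _ _ _ _ (fun r : R => (r + a) / r) (fun x : R => x ^+ d) (1 : R)).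
  exact: exprn_continuous.
have : 1 + a * r^-1 @[r --> +oo%R] --> (1 + a * 0 : R).
  apply: cvgD; first exact: cvg_cst.
  apply: cvgM; first exact: cvg_cst.
  apply/gtr0_cvgV0 => //; near=> r; near: r; exact: nbhs_pinfty_gt.
rewrite mulr0 addr0; apply: cvg_trans; apply: near_eq_cvg.
near=> r; rewrite mulrDl divff ?gt_eqF//; near: r; exact: nbhs_pinfty_gt.
Unshelve. all: by end_near. Qed.

Lemma has_covering_density_periodic (x : nat -> V) : set_bij setT centers x ->
  has_covering_density x q%:E.
Proof.
move=> xbij; rewrite /has_covering_density.
have k0 := kappa_gt0 R d.
have E r : 0 < r -> (\sum_(0 <= i <oo) (vol (eball (x i) 1 `&` eball 0 r) / vol (eball 0 r : set V)) =
    ((r ^+ d * kappa R d)^-1)%:E * mass (eball 0 r))%E.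
  move=> r0; have v0 : 0 < r ^+ d * kappa R d by rewrite mulr_gt0// exprn_gt0.
  rewrite vol_eball// inver gt_eqF//.
  under eq_eseriesr do rewrite muleC.
  rewrite nneseriesZl; last by [].
  rewrite nneseries_esumT//; congr (_ * _)%E.
  by rewrite /mass (reindex_esum setT centers x).
apply: (@squeeze_cvge _ _ _ _
  (fun r => (q * ((r + (- D)) / r) ^+ d)%:E) _ (fun r => (q * ((r + D) / r) ^+ d)%:E)).
- near=> r; have r0 : 0 < r by near: r; exact: nbhs_pinfty_gt.
  have Dr : D < r by near: r; apply: nbhs_pinfty_gt; exact: num_real.
  have v0 : 0 < r ^+ d * kappa R d by rewrite mulr_gt0// exprn_gt0.
  have H (y : R) : (q * (y / r) ^+ d)%:E =
      (((r ^+ d * kappa R d)^-1)%:E * (q * (y ^+ d * kappa R d))%:E)%E.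
    rewrite -EFinM expr_div_n; congr EFin; field.
    by rewrite !gt_eqF// exprn_gt0.
  rewrite E// !H !lee_pmul2l ?lte_fin ?invr_gt0//.
  by rewrite mass_eball_lb// mass_eball_ub.
- apply: cvg_EFin; first exact: nearW.
  rewrite -[X in _ --> X]mulr1; apply: cvgM; [exact: cvg_cst|exact: cvg_pow_shift].
- apply: cvg_EFin; first exact: nearW.
  rewrite -[X in _ --> X]mulr1; apply: cvgM; [exact: cvg_cst|exact: cvg_pow_shift].
Unshelve. all: by end_near. Qed.

Lemma covering_density_le_cube :
  (covering_density R d <= (#|I|%:R * kappa R d / A ^+ d)%:E)%E.
Proof.
have [x xbij] := centers_infinite_countable.
apply: (@le_trans _ _ q%:E).
  apply: ereal_inf_lbound; exists x; split; last exact: has_covering_density_periodic.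
  split; first by move=> m n; have [_ xinj _] := xbij; apply: xinj; rewrite inE.
  rewrite -centers_cover; apply/seteqP; split => v [y].
    by move=> _ yv; exists (x y) => //; have [xf _ _] := xbij; exact: xf.
  by move=> Cy yv; have [_ _ /(_ y Cy)[n _ nE]] := xbij; exists n => //; rewrite nE.
rewrite lee_fin /q ler_pM2r ?invr_gt0 ?exprn_gt0//.
by rewrite -lee_fin fineK ?mass_cell0_le// mass_cell0E.
Qed.

End periodic_covering.

(** * Error factors close to 1 *)

Section limits.
Context (R : realType).

Lemma expr_near1 (k : nat) (c : R) : 1 < c ->
  exists2 e, 0 < e & forall x, 0 <= x <= 1 + e -> x ^+ k <= c.
Proof.
move=> c1; suff [e e0 he] : exists2 e, 0 < e & (1 + e) ^+ k <= c.
  exists e => // x /andP[x0 xe]; apply: le_trans he.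
  by rewrite lerXn2r// nnegrE// addr_ge0// ltW.
have c0 : 0 < c - 1 by rewrite subr_gt0.
have [e /= e0 he] := @cvgr_dist_lt _ _ _ _ _ _ _ (@exprn_continuous R k (1 : R)) _ c0.
exists (e / 2); first by rewrite divr_gt0.
have := he (1 + e / 2); rewrite /ball_ /= opprD addNKr normrN gtr0_norm ?divr_gt0//.
rewrite ltr_pdivrMr// ltr_pMr// ltr1n => /(_ isT).
by rewrite expr1n ltr_norml => /andP[h _]; move: h; lra.
Qed.

Lemma lee_mul_gt1 (k : nat) (x : \bar R) (L : R) : 0 <= L ->
  (forall c, 1 < c -> (x <= (c ^+ k * L)%:E)%E) -> (x <= L%:E)%E.
Proof.
move=> L0 h; apply/lee_addgt0Pr => e e0.
have L1 : 0 < L + 1 by rewrite ltr_wpDl.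
(* Dividing by [L + 1] instead of [L] covers [L = 0]. *)
have c1 : 1 < 1 + e / (L + 1) by rewrite ltrDl divr_gt0.
have [a a0 ha] := expr_near1 k c1.
apply: (le_trans (h (1 + a) _)); first by rewrite ltrDl.
rewrite -EFinD lee_fin (@le_trans _ _ ((1 + e / (L + 1)) * L))//.
  by rewrite ler_wpM2r// ha// lexx addr_ge0// ltW.
rewrite mulrDl mul1r lerD2l mulrAC ler_pdivrMr// ler_wpM2l ?(ltW e0)//.
by rewrite lerDl.
Qed.

Lemma shrink_near1 (k : nat) (c D : R) : 1 < c -> 0 <= D ->
  exists2 M, D < M & forall r, M <= r -> (r / (r - D)) ^+ k <= c.
Proof.
move=> c1 D0; have [e e0 he] := expr_near1 k c1.
have h0 : 0 <= D * (1 + e) / e by rewrite divr_ge0 ?mulr_ge0 ?addr_ge0// ltW.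
(* [r / (r - D) <= 1 + e] amounts to [D * (1 + e) / e <= r]; the rest ensures [D < M]. *)
exists (D * (1 + e) / e + D + 1) => [|r Mr]; first by lra.
have rD : 0 < r - D by lra.
apply: he; apply/andP; split; first by rewrite divr_ge0//; lra.
rewrite ler_pdivrMr//.
have : D * (1 + e) / e <= r by lra.
rewrite ler_pdivrMr//; nra.
Qed.

End limits.

Section flat_lower.
Context (R : realType) (d : nat).
Hypothesis d0 : (0 < d)%N.
Local Notation V := 'rV[R]_d.

(** Translating the covering by [t] of norm at most [rho - d * A] keeps the cube covered. Only balls
    centered in the cube enlarged by 1 on every side are needed, and averaging over [t] bounds their
    number by the volume ratio. *)
Lemma cube_cover_of_ball (A rho : R) (I : finType) (c : I -> V) :
  0 < A -> d%:R * A < rho -> eball 0 rho `<=` \bigcup_k eball (c k) 1 ->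
  exists (J : finType) (c' : J -> V), cube d A `<=` \bigcup_k eball (c' k) 1 /\
    #|J|%:R <= #|I|%:R * (A + 2) ^+ d / ((rho - d%:R * A) ^+ d * kappa R d).
Proof.
move=> A0 Arho cov.
(* The translations that bring [c k] into the enlarged cube; [const_mx 1] moves the corner of that
   cube to the origin. *)
pose S k := [set t : V | cube d (A + 2) (t + (c k + const_mx 1))].
have mS k : measurable (S k).
  apply: (measurable_preimage _ (@measurable_cube R d (A + 2))).
  exact: measurable_rowD.
have r0 : 0 < rho - d%:R * A by rewrite subr_gt0.
have A2 : 0 <= A + 2 by rewrite addr_ge0// ltW.
have v0 : 0 < (rho - d%:R * A) ^+ d * kappa R d.
  by rewrite mulr_gt0 ?exprn_gt0 ?kappa_gt0.
pose B := eball (0 : V) (rho - d%:R * A).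
have mB : measurable B by exact: measurable_eball.
have vB : vol B = ((rho - d%:R * A) ^+ d * kappa R d)%:E by rewrite vol_eball.
have [|||t Bt ht] := @exists_few_indic _ _ R (@vol R d) I S B
  (#|I|%:R * (A + 2) ^+ d / ((rho - d%:R * A) ^+ d * kappa R d)) _ mB mS.
- by apply: divr_ge0; [apply: mulr_ge0 => //; exact: exprn_ge0|exact: ltW].
- by rewrite /= vB lte_fin v0 ltry.
- rewrite /= vB -EFinM divfK ?gt_eqF//.
  apply: (@le_trans _ _ (\sum_(i : I) ((A + 2) ^+ d)%:E)%E).
    apply: lee_sum => k _; rewrite -(vol_cube d A2).
    rewrite -(vol_translate (c k + const_mx 1) (@measurable_cube R d (A + 2))).
    by apply: le_measure; rewrite ?inE; [exact: measurableI|exact: mS|exact: subIsetl].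
  by rewrite sumEFin sumr_const mulr_natl.
pose P := [pred k | t \in S k].
exists {k | P k}, (fun k => c (val k) + t); split; last first.
  rewrite card_sig; apply: le_trans ht.
  rewrite -sum1_card natr_sum big_mkcond /=; apply: ler_sum => k _.
  by rewrite indicE inE /=; case: (t \in S k).
move=> v vA.
have [k _ kv] : (\bigcup_k eball (c k) 1) (v - t).
  apply: cov; rewrite /eball /= subr0.
  rewrite (le_trans (enormD _ _))// enormN.
  have : enorm v <= d%:R * A by exact: cube_enorm.
  by move: Bt; rewrite /B /eball /= subr0; lra.
have Pk : P k.
  rewrite /P /= inE /S /= => i; rewrite !mxE.
  have := le_trans (coord_le_enorm _ i) kv; rewrite !mxE ler_norml.
  by have := vA i; lra.
exists (exist _ k Pk) => //=.
by move: kv; rewrite /eball /= opprD addrA addrAC.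
Qed.

Lemma covering_density_le_of_balls (L : R) : 0 <= L ->
  (forall M, exists2 rho, M <= rho & exists (I : finType) (c : I -> V),
    eball 0 rho `<=` \bigcup_k eball (c k) 1 /\ #|I|%:R <= L * rho ^+ d) ->
  (covering_density R d <= L%:E)%E.
Proof.
(* One factor [b] pays for the margin of the cube, the other for shrinking [rho] by [d * A]. [A] is
   fixed before [rho]. *)
move=> L0 h; apply: (@lee_mul_gt1 _ 2) => // b b1.
have [A A0 hA] : exists2 A : R, 0 < A & ((A + 2) / A) ^+ d <= b.
  have [e e0 he] := expr_near1 d b1.
  have A0 : 0 < 2 / e by rewrite divr_gt0.
  exists (2 / e) => //; apply: he; apply/andP; split.
    by rewrite divr_ge0 ?addr_ge0// ltW.
  by rewrite le_eqVlt; apply/orP; left; apply/eqP; field; rewrite gt_eqF.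
have dA0 : 0 <= d%:R * A by rewrite mulr_ge0// ltW.
have [M DM hM] := shrink_near1 d b1 dA0.
have [rho Mrho [I [c [cov cI]]]] := h M.
have dArho : d%:R * A < rho by exact: lt_le_trans Mrho.
have [J [c' [cov' cJ]]] := cube_cover_of_ball A0 dArho cov.
apply: (le_trans (covering_density_le_cube d0 A0 cov')).
rewrite lee_fin; have k0 := kappa_gt0 R d.
have r0 : 0 < rho - d%:R * A by rewrite subr_gt0.
apply: (@le_trans _ _ ((rho / (rho - d%:R * A)) ^+ d * ((A + 2) / A) ^+ d * L)).
  rewrite !expr_div_n ler_pdivrMr ?exprn_gt0//.
  have {}cJ : #|J|%:R * kappa R d * (rho - d%:R * A) ^+ d <= #|I|%:R * (A + 2) ^+ d.
    by rewrite -mulrA [kappa _ _ * _]mulrC -ler_pdivlMr// mulr_gt0// exprn_gt0.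
  have -> : rho ^+ d / (rho - d%:R * A) ^+ d * ((A + 2) ^+ d / A ^+ d) * L * A ^+ d =
     L * rho ^+ d * (A + 2) ^+ d / (rho - d%:R * A) ^+ d.
    by field; rewrite !gt_eqF ?exprn_gt0.
  rewrite ler_pdivlMr ?exprn_gt0// (le_trans cJ)//.
  by rewrite ler_wpM2r// exprn_ge0// addr_ge0// ltW.
rewrite ler_wpM2r// expr2 ler_pM ?exprn_ge0//.
- by apply: divr_ge0; [exact: le_trans dA0 (ltW dArho)|exact: ltW].
- by rewrite divr_ge0 ?addr_ge0// ltW.
- exact: hM.
Qed.

End flat_lower.

Section flat_upper.
Context (R : realType) (d : nat) (x : nat -> 'rV[R]_d) (l : R).
Hypothesis xl : has_covering_density x l%:E.
Local Notation V := 'rV[R]_d.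

Let near_centers (r : R) : set nat := [set i | enorm (x i) <= r - 1].

(** A unit ball centered within [r - 1] of the origin lies wholly in the ball of radius [r] and adds
    exactly [r ^- d] to the density sum. Finiteness follows as well, the bound holding for every
    finite subset. *)
Lemma near_centers_bound (m : R) : l < m ->
  \forall r \near +oo%R, finite_set (near_centers r) /\
    #|` fset_set (near_centers r)|%:R <= m * r ^+ d.
Proof.
move=> lm.
have H : \forall r \near +oo%R, (\sum_(0 <= i <oo)
    (vol (eball (x i) 1 `&` eball 0 r) / vol (eball 0 r : set V)) < m%:E)%E.
  have U : nbhs l%:E [set y | (y < m%:E)%E].
    by apply: open_nbhs_nbhs; split; [exact: open_ereal_lt_ereal|rewrite /= lte_fin].
  exact: (xl U).
near=> r.
have r0 : 0 < r by near: r; exact: nbhs_pinfty_gt.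
have Hr : (\sum_(0 <= i <oo) (vol (eball (x i) 1 `&` eball 0 r) / vol (eball 0 r : set V)) < m%:E)%E.
  by near: r.
have k0 := kappa_gt0 R d.
have v0 : 0 < r ^+ d * kappa R d by rewrite mulr_gt0// exprn_gt0.
have a0 i : (0 <= vol (eball (x i) 1 `&` eball 0 r) / vol (eball 0 r : set V))%E.
  by rewrite vol_eball// inver gt_eqF// mule_ge0// lee_fin invr_ge0 ltW.
have card_le (F : {fset nat}) : [set` F] `<=` near_centers r -> #|` F|%:R <= m * r ^+ d.
  move=> Fr; rewrite -ler_pdivrMr ?exprn_gt0//.
  rewrite -lee_fin; apply: le_trans (ltW Hr).
  rewrite nneseries_esumT//; apply: esum_ge; exists [set` F] => //.
  rewrite -fsbig_seq ?fset_uniq//.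
  rewrite big_seq (eq_bigr (fun=> (r ^- d)%:E)); last first.
    move=> i iF; have -> : eball (x i) 1 `&` eball 0 r = eball (x i) 1.
      apply/setIidPl => v; rewrite /eball /= subr0 => vx.
      rewrite -(subrK (x i) v) (le_trans (enormD _ _))//.
      by have := Fr _ iF; rewrite /near_centers /=; lra.
    rewrite !vol_eball// inver gt_eqF// -EFinM; congr EFin.
    by rewrite expr1n; field; rewrite !gt_eqF// exprn_gt0.
  by rewrite -big_seq sumEFin big_const_seq count_predT iter_addr_0 mulr_natl.
have fin : finite_set (near_centers r).
  apply: contrapT => /(@infinite_set_fset _ _ (Num.truncn (m * r ^+ d)).+1)[F Fsub].
  rewrite -(ler_nat R) => h.
  have := truncnS_gt (m * r ^+ d).
  by rewrite ltNge (le_trans h)// card_le.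
split=> //; apply: card_le; rewrite fset_setK//.
Unshelve. all: by end_near. Qed.

(** Average over translations [u] of norm at most [r - (1 + D)]: only centers within [r - 1] of the
    origin can reach [W], and each does so for a set of [u] of volume at most [vol W]. *)
Lemma few_centers_in (W : set V) (D m : R) : l < m -> 0 < m -> 0 <= D ->
  measurable W -> (forall v, W v -> enorm v <= D) ->
  exists (u : V) (s : seq nat), (forall i, W (x i + u) -> i \in s) /\
    ((size s)%:R%:E <= (m / kappa R d)%:E * vol W)%E.
Proof.
move=> lm m0 D0 mW WD.
(* The gap between [m1] and [m] absorbs the ratio of the balls of radii [r] and [r - (1 + D)]. The
   second term of the maximum makes [m1] positive whatever the sign of [l]. *)
have [m1 [m10 lm1 m1m]] : exists m1, [/\ 0 < m1, l < m1 & m1 < m].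
  exists (Num.max ((l + m) / 2) (m / 2)).
  rewrite !lt_max gt_max; split; last by apply/andP; split; lra.
    by apply/orP; right; lra.
  by apply/orP; left; lra.
have c1 : 1 < m / m1 by rewrite ltr_pdivlMr// mul1r.
have D1 : 0 <= 1 + D by rewrite addr_ge0.
have [M DM hM] := shrink_near1 d c1 D1.
near +oo_R => r.
have Mr : M <= r by near: r; apply: nbhs_pinfty_ge; exact: num_real.
have [fin cardJ] : finite_set (near_centers r) /\
    #|` fset_set (near_centers r)|%:R <= m1 * r ^+ d.
  by near: r; exact: near_centers_bound.
have r1 : 0 < r - (1 + D) by rewrite subr_gt0 (lt_le_trans DM).
pose J := fset_set (near_centers r).
pose S (k : J) := [set u : V | W (u + x (val k))].
have mS k : measurable (S k).
  by apply: (measurable_preimage _ mW); exact: measurable_rowD.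
pose B := eball (0 : V) (r - (1 + D)).
have mB : measurable B by exact: measurable_eball.
have k0 := kappa_gt0 R d.
have v0 : 0 < (r - (1 + D)) ^+ d * kappa R d by rewrite mulr_gt0// exprn_gt0.
have vB : vol B = ((r - (1 + D)) ^+ d * kappa R d)%:E by rewrite vol_eball.
have [w w0 vW] : exists2 w, 0 <= w & vol W = w%:E.
  exists (fine (vol W)); first exact: fine_ge0.
  by rewrite fineK// ge0_fin_numE// (vol_bounded_lty mW WD).
have [|||u Bu hu] := @exists_few_indic _ _ R (@vol R d) J S B
  (#|{: J}|%:R * w / ((r - (1 + D)) ^+ d * kappa R d)) _ mB mS.
- by apply: divr_ge0; [exact: mulr_ge0|exact: ltW].
- by rewrite /= vB lte_fin v0 ltry.
- rewrite /= vB -EFinM divfK ?gt_eqF//.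
  apply: (@le_trans _ _ (\sum_(i : J) w%:E)%E).
    apply: lee_sum => k _; rewrite -vW -(vol_translate (x (val k)) mW).
    by apply: le_measure; rewrite ?inE; [exact: measurableI|exact: mS|exact: subIsetl].
  by rewrite sumEFin sumr_const mulr_natl.
exists u, [seq i <- J | u \in [set u : V | W (u + x i)]]; split.
  move=> i Wi; rewrite mem_filter; apply/andP; split.
    by apply/mem_set; rewrite /= addrC.
  rewrite in_fset_set//; apply/mem_set.
  rewrite /near_centers /= -(addrK u (x i)) (le_trans (enormD _ _))// enormN.
  by have := WD _ Wi; move: Bu; rewrite /B /eball /= subr0; lra.
rewrite vW -EFinM lee_fin.
apply: (@le_trans _ _ (\sum_k \1_(S k) u)).
  rewrite size_filter -sum1_count natr_sum big_mkcond /= big_seq_fsetE /=.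
  by apply: ler_sum => k _; rewrite indicE /S; case: (u \in _).
apply: (le_trans hu).
have cJ : #|{: J}|%:R <= m1 * r ^+ d by rewrite -cardfE.
rewrite ler_pdivrMr//.
apply: (@le_trans _ _ (m1 * r ^+ d * w)); first by rewrite ler_wpM2r.
have := hM _ Mr; rewrite expr_div_n ler_pdivrMr ?exprn_gt0// => h.
have -> : m / kappa R d * w * ((r - (1 + D)) ^+ d * kappa R d) =
  m1 * (m / m1 * (r - (1 + D)) ^+ d) * w by field; rewrite !gt_eqF.
by rewrite ler_wpM2r// ler_wpM2l// ltW.
Unshelve. all: by end_near. Qed.

End flat_upper.

(** * Spherical caps and the gnomonic projection *)

Section householder_reflection.
Context (R : realType) (d : nat).
Local Notation V := 'rV[R]_d.+1.
Implicit Types u v w x : V.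

Lemma inner_rcons v w : inner v w = v 0 0 * w 0 0 + inner (rtail v) (rtail w).
Proof.
rewrite /inner big_ord_recl; congr (_ + _).
by apply: eq_bigr => i _; rewrite !mxE.
Qed.

Lemma enorm_rcons v : enorm v ^+ 2 = v 0 0 ^+ 2 + enorm (rtail v) ^+ 2.
Proof. by rewrite !enorm_sqr inner_rcons -expr2. Qed.

Lemma enorm_rtail_le v : enorm (rtail v) <= enorm v.
Proof.
rewrite -(@ler_pXn2r _ 2)// ?nnegrE ?enorm_ge0// enorm_rcons.
by rewrite lerDr sqr_ge0.
Qed.

Definition pole : V := rcons0 1 0.

Lemma inner_pole v : inner pole v = v 0 0.
Proof.
by rewrite inner_rcons rcons0_0 mul1r rcons0K inner0l addr0.
Qed.

Lemma enorm_pole : enorm pole = 1.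
Proof. by rewrite /enorm inner_pole rcons0_0 sqrtr1. Qed.

(* Householder reflection exchanging [pole] and the unit vector [x]; for
   [x = pole] the inverse of [0] is [0] and it is the identity. *)
Definition householder x v : V :=
  v - (2 * inner (pole - x) v / inner (pole - x) (pole - x)) *: (pole - x).

Lemma householderD x u v : householder x (u + v) = householder x u + householder x v.
Proof.
rewrite /householder innerDr mulrDr mulrDl scalerDl opprD.
by rewrite addrACA.
Qed.

Lemma householderZ x a v : householder x (a *: v) = a *: householder x v.
Proof.
rewrite /householder innerZr [RHS]scalerBr scalerA; congr (_ - _ *: _).
by rewrite !mulrA [2 * a]mulrC.
Qed.

Lemma inner_householder x u v : inner (householder x u) (householder x v) = inner u v.
Proof.
rewrite /householder; move: (pole - x) => w.
have [w0|w0] := eqVneq (inner w w) 0.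
  by rewrite (inner_eq0 w0) !scaler0 !subr0.
rewrite !innerDl !innerDr !innerNl !innerNr !innerZl !innerZr (innerC u w).
by field.
Qed.

Lemma enorm_householder x v : enorm (householder x v) = enorm v.
Proof. by rewrite /enorm inner_householder. Qed.

Lemma householderK x v : householder x (householder x v) = v.
Proof.
rewrite /householder; move: (pole - x) => w.
have [w0|w0] := eqVneq (inner w w) 0; first by rewrite (inner_eq0 w0) !scaler0 !subr0.
rewrite innerDr innerNr innerZr -addrA -opprD -scalerDl.
have -> : 2 * inner w v / inner w w +
    2 * (inner w v - 2 * inner w v / inner w w * inner w w) / inner w w = 0 by field.
by rewrite scale0r subr0.
Qed.

Lemma householder_pole x : enorm x = 1 -> householder x pole = x.
Proof.
move=> x1; rewrite /householder; set w := pole - x.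
have [w0|w0] := eqVneq (inner w w) 0.
  by rewrite (inner_eq0 w0) scaler0 subr0; apply/eqP; rewrite -subr_eq0 -/w (inner_eq0 w0).
have -> : 2 * inner w pole / inner w w = 1; last by rewrite scale1r /w opprB addrC subrK.
suff -> : inner w w = 2 * inner w pole.
  by rewrite divff//; apply: contraNneq w0 => h; rewrite -enorm_sqr edist_sqr
    enorm_pole x1; move: h; rewrite /w innerDl innerNl -(enorm_sqr pole) enorm_pole (innerC x) => h;
    apply/eqP; lra.
rewrite -enorm_sqr edist_sqr enorm_pole x1 /w innerDl innerNl -(enorm_sqr pole) enorm_pole.
by rewrite (innerC x); ring.
Qed.

Lemma inner_householder_pole x v : enorm x = 1 -> inner x v = householder x v 0 0.
Proof.
by move=> x1; rewrite -inner_pole -{1}(householder_pole x1) -{1}(householderK x v) inner_householder.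
Qed.

Lemma measurable_householder x : measurable_fun [set: V] (householder x).
Proof.
apply: measurable_rowB => //; apply: measurable_rowZ => //.
by do 2 apply: measurable_funM => //; exact: measurable_inner.
Qed.

Lemma vol_householder x (S : set V) : measurable S -> vol [set v | S (householder x v)] = vol S.
Proof.
apply: vol_isometry; [exact: measurable_householder|exact: householderD|exact: householderK|].
exact: enorm_householder.
Qed.

End householder_reflection.
Arguments pole {R d}.

Section gnomonic.
Context (R : realType).

(* [(sec t)^-1] is the cosine of the angular radius of the cap whose image under
   gnomonic projection from its center is the ball of radius [t]. *)
Definition sec (t : R) : R := Num.sqrt (1 + t ^+ 2).

Lemma sec_sqr t : sec t ^+ 2 = 1 + t ^+ 2.
Proof. by rewrite sqr_sqrtr// addr_ge0// sqr_ge0. Qed.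

Lemma sec_gt0 t : 0 < sec t.
Proof. by rewrite sqrtr_gt0 ltr_pwDl// sqr_ge0. Qed.

Lemma sec_ge0 t : 0 <= sec t. Proof. exact: sqrtr_ge0. Qed.

Lemma sec_ge1 t : 1 <= sec t.
Proof. by rewrite -{1}sqrtr1 ler_wsqrtr// lerDl sqr_ge0. Qed.

Lemma sec_le t : 0 <= t -> sec t <= 1 + t.
Proof.
move=> t0; rewrite -(@ler_pXn2r _ 2)// ?nnegrE ?addr_ge0 ?sec_ge0//.
rewrite sec_sqr -subr_ge0 (_ : _ - _ = 2 * t); last by ring.
by rewrite mulr_ge0.
Qed.

Lemma ler_sec s t : 0 <= s -> s <= t -> sec s <= sec t.
Proof. by move=> s0 st; rewrite ler_wsqrtr// lerD2l lerXn2r// nnegrE (le_trans s0). Qed.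

Variable d : nat.
Local Notation V := 'rV[R]_d.+1.
Implicit Types (u v x y : V) (g : 'rV[R]_d).

(** Squared, both sides compare [enorm (rtail v) ^+ 2] with [t ^+ 2 * v 0 0 ^+ 2]. Caps about the
    pole thus become balls in the tangent hyperplane. *)
Lemma gnomonicE v t : 0 < v 0 0 -> 0 <= t ->
  ((sec t)^-1 * enorm v <= v 0 0) = (enorm ((v 0 0)^-1 *: rtail v) <= t).
Proof.
move=> v0 t0; have s0 := sec_gt0 t; have v0' := ltW v0; have s0' := ltW s0.
rewrite enormZ gtr0_norm ?invr_gt0//.
rewrite [_ * enorm v]mulrC ler_pdivrMr// [_ * enorm _]mulrC ler_pdivrMr//.
rewrite -[LHS](@ler_pXn2r _ 2)// ?nnegrE ?mulr_ge0 ?enorm_ge0//.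
rewrite -[RHS](@ler_pXn2r _ 2)// ?nnegrE ?mulr_ge0 ?enorm_ge0//.
rewrite !exprMn sec_sqr enorm_rcons mulrDr mulr1 lerD2l.
by rewrite mulrC.
Qed.

Lemma rcons1_homogeneous v : 0 < v 0 0 -> v = v 0 0 *: rcons0 1 ((v 0 0)^-1 *: rtail v).
Proof.
move=> v0; apply/rowP => i; rewrite !mxE; case: unliftP => [j ->|->]; last by rewrite mulr1.
by rewrite !mxE mulrA mulfV ?gt_eqF// mul1r.
Qed.

(** The inverse gnomonic projection: a point of the hyperplane tangent at [pole], normalized. *)
Definition gno g : V := (sec (enorm g))^-1 *: rcons0 1 g.

Lemma gno0 g : gno g 0 0 = (sec (enorm g))^-1.
Proof. by rewrite !mxE unlift_none mulr1. Qed.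

Lemma rtail_gno g : rtail (gno g) = (sec (enorm g))^-1 *: g.
Proof. by apply/rowP => i; rewrite !mxE liftK. Qed.

Lemma enorm_rcons1 g : enorm (rcons0 1 g) = sec (enorm g).
Proof. by rewrite /sec enorm_sqr /enorm inner_rcons rcons0_0 mulr1 rcons0K. Qed.

Lemma enorm_gno g : enorm (gno g) = 1.
Proof.
have s0 := sec_gt0 (enorm g).
by rewrite /gno enormZ enorm_rcons1 gtr0_norm ?invr_gt0// mulVf ?gt_eqF.
Qed.

Lemma gnoK v : enorm v = 1 -> 0 < v 0 0 -> gno ((v 0 0)^-1 *: rtail v) = v.
Proof.
move=> v1 v0; set g := _ *: _.
have vE : v = v 0 0 *: rcons0 1 g := rcons1_homogeneous v0.
have : enorm v = v 0 0 * sec (enorm g) by rewrite {1}vE enormZ gtr0_norm// enorm_rcons1.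
rewrite v1 => h; rewrite /gno [RHS]vE; congr (_ *: _).
by apply: (@mulIf _ (sec (enorm g))); rewrite ?gt_eqF ?sec_gt0// -h mulVf// gt_eqF// sec_gt0.
Qed.

(** For unit vectors [u], [v] the squared length of [a u - b v] is [(a - b)^2] plus [a b] times that
    of [u - v]. Here [a u] and [b v] are the points at height 1 over [g] and [h]. *)
Lemma gno_dist_sqr g h : enorm (g - h) ^+ 2 =
  (sec (enorm g) - sec (enorm h)) ^+ 2 +
  sec (enorm g) * sec (enorm h) * enorm (gno g - gno h) ^+ 2.
Proof.
have a0 := sec_gt0 (enorm g); have b0 := sec_gt0 (enorm h).
rewrite !edist_sqr !enorm_gno /gno innerZl innerZr inner_rcons !rcons0_0 !rcons0K.
have := sec_sqr (enorm g); have := sec_sqr (enorm h).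
move: (sec _) (sec _) a0 b0 => b a b0 a0 hb ha.
have -> : a * b * (1 ^+ 2 + 1 ^+ 2 - 2 * (a^-1 * (b^-1 * (1 * 1 + inner g h)))) =
   2 * a * b - 2 * (1 + inner g h) by field; rewrite !gt_eqF.
by rewrite sqrrB ha hb; ring.
Qed.

Lemma gno_dist_le g h : enorm (gno g - gno h) <= enorm (g - h).
Proof.
rewrite -(@ler_pXn2r _ 2)// ?nnegrE ?enorm_ge0// gno_dist_sqr.
have a1 := sec_ge1 (enorm g); have b1 := sec_ge1 (enorm h).
apply: (@le_trans _ _ (sec (enorm g) * sec (enorm h) * enorm (gno g - gno h) ^+ 2)).
  by rewrite ler_peMl ?sqr_ge0// mulr_ege1.
by rewrite lerDr sqr_ge0.
Qed.

(** The radial term of [gno_dist_sqr] is small: the secants differ in their squares as the norms do,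
    the secants add up to at least 2 and the norms to at most [2 * e]. *)
Lemma gno_dist_ge g h e : 0 <= e -> enorm g <= e -> enorm h <= e ->
  (1 - e ^+ 2) * enorm (g - h) ^+ 2 <= (1 + e ^+ 2) * enorm (gno g - gno h) ^+ 2.
Proof.
move=> e0 ge he; have := gno_dist_sqr g h.
have a1 := sec_ge1 (enorm g); have b1 := sec_ge1 (enorm h).
have ab : sec (enorm g) * sec (enorm h) <= 1 + e ^+ 2.
  rewrite -sec_sqr expr2 ler_pM ?(le_trans ler01)//; exact: ler_sec (enorm_ge0 _) _.
have sq : (sec (enorm g) - sec (enorm h)) ^+ 2 <= e ^+ 2 * enorm (g - h) ^+ 2.
  have E : (sec (enorm g) - sec (enorm h)) * (sec (enorm g) + sec (enorm h)) =
      (enorm g - enorm h) * (enorm g + enorm h).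
    by rewrite -!subr_sqr !sec_sqr; ring.
  have t1 : `|enorm g - enorm h| <= enorm (g - h).
    rewrite ler_norml; have := enormD (g - h) h; have := enormD (h - g) g.
    by rewrite !subrK (edistC h g); lra.
  have s1 : `|sec (enorm g) - sec (enorm h)| <= e * enorm (g - h).
    have := congr1 (fun z => `|z|) E; rewrite !normrM.
    rewrite [X in _ * X = _]ger0_norm; last by lra.
    rewrite [X in _ = _ * X]ger0_norm ?addr_ge0 ?enorm_ge0// => E'.
    have N0 := normr_ge0 (sec (enorm g) - sec (enorm h)).
    have h0 := enorm_ge0 g; have h1 := enorm_ge0 h.
    have : `|enorm g - enorm h| * (enorm g + enorm h) <= enorm (g - h) * (2 * e).
      by apply: ler_pM => //; lra.
    rewrite -E'; move: a1 b1 N0 (enorm_ge0 (g - h)); nra.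
  by rewrite -exprMn -real_normK ?num_real// lerXn2r// nnegrE mulr_ge0// enorm_ge0.
have := ler_wpM2r (sqr_ge0 (enorm (gno g - gno h))) ab.
nra.
Qed.

Lemma chord_le_of_inner x y t : enorm x = 1 -> enorm y = 1 -> 0 <= t ->
  (sec t)^-1 <= inner x y -> enorm (x - y) <= t.
Proof.
move=> x1 y1 t0 h; rewrite -(@ler_pXn2r _ 2)// ?nnegrE ?enorm_ge0//.
rewrite edist_sqr x1 y1.
have := sec_sqr t; have := sec_ge1 t; have := sec_gt0 t.
move: (sec t) h => s h s0 s1 hs.
have sv : s * s^-1 = 1 by rewrite mulfV// gt_eqF.
have si : 0 < s^-1 by rewrite invr_gt0.
have : 2 - 2 * s^-1 <= s ^+ 2 - 1.
  suff : 0 <= (s - 1) * (s * (s + 1) - 2) * s^-1.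
    have -> : (s - 1) * (s * (s + 1) - 2) * s^-1 =
        (s ^+ 2 - 1) * (s * s^-1) - 2 * (s * s^-1) + 2 * s^-1 by ring.
    by rewrite sv; lra.
  by rewrite mulr_ge0 ?(ltW si)// mulr_ge0//; nra.
by rewrite hs expr1n; lra.
Qed.

(** [t / sec t] is the sine of the angular radius of the cap, and a chord is at least as long as the
    sine of its angle. *)
Lemma inner_ge_of_chord x y t : enorm x = 1 -> enorm y = 1 -> 0 <= t ->
  sec t * enorm (x - y) <= t -> (sec t)^-1 <= inner x y.
Proof.
move=> x1 y1 t0; have s0 := sec_gt0 t; have hs := sec_sqr t.
rewrite -(@ler_pXn2r _ 2)// ?nnegrE ?mulr_ge0 ?enorm_ge0 ?sec_ge0// exprMn.
rewrite edist_sqr x1 y1 hs.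
move: (sec t) s0 hs => s s0 hs.
have sv : s * s^-1 = 1 by rewrite mulfV// gt_eqF.
have si : 0 < s^-1 by rewrite invr_gt0.
move=> h; have : 0 <= (1 - s^-1) ^+ 2 by rewrite sqr_ge0.
have : 2 - 2 * inner x y <= 1 - s^-1 ^+ 2.
  rewrite -hs in h; have -> : 1 - s^-1 ^+ 2 = (s ^+ 2 - 1) * s^-1 ^+ 2.
    by rewrite mulrBl -exprMn sv expr1n mul1r.
  rewrite exprVn ler_pdivlMr ?exprn_gt0//; nra.
nra.
Qed.

End gnomonic.

Section capcone.
Context (R : realType) (d : nat).
Local Notation V := 'rV[R]_d.+1.
Local Notation beta := (kappa R d.+1).

Definition capcone (x : V) (c : R) : set V :=
  [set v | enorm v <= 1 /\ c * enorm v <= inner x v].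

Lemma measurable_capcone x c : measurable (capcone x c).
Proof.
apply: measurableI.
  by apply: measurable_le => //; exact: measurable_enorm.
apply: measurable_le; last exact: measurable_inner.
by apply: measurable_funM => //; exact: measurable_enorm.
Qed.

Lemma capcone_householder x c : enorm x = 1 ->
  capcone x c = [set v | capcone pole c (householder x v)].
Proof.
move=> x1; apply: eq_set => v.
by rewrite /capcone /mkset enorm_householder (inner_householder_pole v x1) inner_pole.
Qed.

Lemma vol_capcone_pole x c : enorm x = 1 -> vol (capcone x c) = vol (capcone pole c).
Proof.
by move=> x1; rewrite (capcone_householder c x1) vol_householder//; exact: measurable_capcone.
Qed.

(** A point at height [h] over the ball of radius [t] has norm at most [h * sec t], so [(sec t)^-1]
    is the height at which the inner pyramid must be cut; the outer one has height 1. *)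
Lemma pyramid_sub_ball t (G : set 'rV[R]_d) : 0 <= t -> (forall g, G g -> enorm g <= t) ->
  pyramid (sec t)^-1 G `<=` [set v : V | 0 < v 0 0 /\ capcone pole (sec t)^-1 v].
Proof.
move=> t0 Gt v [/andP[v0 vt] /Gt]; rewrite -gnomonicE// => h; split=> //.
have s0 := sec_gt0 t; split; last by rewrite inner_pole.
by move: (le_trans h vt); rewrite ger_pMr ?invr_gt0.
Qed.

Lemma vol_capcone_le x t : enorm x = 1 -> 0 < t ->
  (vol (capcone x (sec t)^-1) <= (gam R d * (t ^+ d * kappa R d))%:E)%E.
Proof.
move=> x1 t0; rewrite vol_capcone_pole//.
have mp : measurable (pyramid 1 (eball (0%R : 'rV[R]_d) t)).
  by apply: measurable_pyramid; exact: measurable_eball.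
have m0 := measurable_row_set1 (0 : V).
have -> : ((gam R d * (t ^+ d * kappa R d))%:E =
    vol (pyramid 1 (eball (0%R : 'rV[R]_d) t)) + vol [set (0%R : V)])%E.
  rewrite vol_set1 adde0 vol_pyramid//; last exact: measurable_eball.
  by rewrite expr1n mul1r vol_eball.
apply: (@le_trans _ _ (vol (pyramid 1 (eball (0%R : 'rV[R]_d) t) `|` [set 0]))).
  apply: le_measure; rewrite ?inE; [exact: measurable_capcone|exact: measurableU|].
  move=> v [v1]; rewrite inner_pole => h.
  have [vn0|vn0] := eqVneq (enorm v) 0; first by right; exact: enorm_eq0.
  have v0 : 0 < v 0 0.
    apply: lt_le_trans h; rewrite mulr_gt0 ?invr_gt0 ?sec_gt0//.
    by rewrite lt0r vn0 enorm_ge0.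
  left; split; last by rewrite /eball /= subr0 -gnomonicE// ltW.
  by rewrite v0 (le_trans _ v1)// (le_trans (ler_norm _))// coord_le_enorm.
exact: measureU2.
Qed.

Lemma vol_capcone_ge x t : enorm x = 1 -> 0 < t ->
  (((sec t)^-1 ^+ d.+1 * (gam R d * (t ^+ d * kappa R d)))%:E <= vol (capcone x (sec t)^-1))%E.
Proof.
move=> x1 t0; rewrite vol_capcone_pole//.
have mB := @measurable_eball R d 0 t.
have s0 := sec_gt0 t.
rewrite (mulrA _ (gam R d)) EFinM -(vol_eball (0%R : 'rV[R]_d) t0) -vol_pyramid ?invr_gt0//.
apply: le_measure; rewrite ?inE; [exact: measurable_pyramid|exact: measurable_capcone|].
apply: subset_trans (pyramid_sub_ball (ltW t0) _) _.
  by move=> g; rewrite /eball /= subr0.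
by move=> v [].
Qed.

Lemma le_acos (t phi : R) : -1 <= t <= 1 -> 0 <= phi <= pi ->
  (acos t <= phi) = (cos phi <= t).
Proof.
move=> t1 phi1; rewrite leNgt -(@ltr_cos R) ?in_itv//=; last first.
  by rewrite acos_ge0// acos_lepi.
by rewrite acosK ?in_itv//= -leNgt.
Qed.

Lemma sigma_cap (x : V) (phi : R) : enorm x = 1 -> 0 <= phi <= pi ->
  sigma (cap x phi) = (beta^-1%:E * vol (capcone x (cos phi)))%E.
Proof.
move=> x1 phi1; rewrite /sigma vol_eball// expr1n mul1r inver gt_eqF ?kappa_gt0//.
rewrite muleC; congr (_ * vol _)%E; apply/seteqP; split => v.
  move=> [t [y [/andP[t0 t1] [[y1 hy] _] ->]]]; rewrite /sphere /= in y1.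
  rewrite le_acos ?sphere_bound// in hy.
  rewrite /capcone /= enormZ y1 mulr1 ger0_norm// innerZr; split => //.
  by rewrite mulrC ler_wpM2l.
move=> [v1 hv]; have [v0|v0] := eqVneq (enorm v) 0.
  (* The apex is 0 times any point of the cap, and [x] is such a point because [acos 1 = 0]. *)
  exists 0, x; split; first by rewrite lexx ler01.
    split=> //; split=> //; rewrite -enorm_sqr x1 expr1n acos1; by case/andP: phi1.
  by rewrite scale0r; exact: enorm_eq0.
have vp : 0 < enorm v by rewrite lt0r v0 enorm_ge0.
have y1 : enorm ((enorm v)^-1 *: v) = 1.
  by rewrite enormZ gtr0_norm ?invr_gt0// mulVf.
exists (enorm v), ((enorm v)^-1 *: v); split; first by rewrite v1 ltW.
  split=> //; split=> //; rewrite le_acos ?sphere_bound// innerZr.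
  by rewrite mulrC ler_pdivlMr.
by rewrite scalerA mulfV// scale1r.
Qed.

End capcone.

(** * The lower bound *)

Section sphere_lower.
Context (R : realType) (d : nat).
Hypothesis d0 : (0 < d)%N.
Local Notation V := 'rV[R]_d.+1.
Local Notation beta := (kappa R d.+1).
(** The cone over a cap of gnomonic radius [t] has volume about [ccap * t ^+ d]; dividing by [beta]
    gives its [sigma]. *)
Local Notation ccap := (gam R d * kappa R d).

Lemma ccap_gt0 : 0 < ccap.
Proof. by rewrite mulr_gt0 ?gam_gt0 ?kappa_gt0. Qed.

Lemma expr_root (a : R) : 0 < a -> exists2 t, 0 < t & t ^+ d = a.
Proof.
move=> a0; exists (a `^ d%:R^-1); first exact: powR_gt0.
rewrite -powR_mulrn ?powR_ge0// -powRrM mulVf ?pnatr_eq0 -?lt0n//.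
by rewrite powRr1// ltW.
Qed.

(** Average over nonzero vectors of the unit ball, each then normalized to the center [y]. The
    origin is removed because it lies in all the cones and has no direction. *)
Lemma few_in_cap (I : finType) (x : I -> V) (T : R) : 0 < T ->
  (forall i, enorm (x i) = 1) -> exists2 y, enorm y = 1 &
  #|[pred i | (sec T)^-1 <= inner y (x i)]|%:R <= #|I|%:R * (ccap * T ^+ d / beta).
Proof.
move=> T0 x1; have b0 := kappa_gt0 R d.+1; have g0 := ccap_gt0.
pose S i := capcone (x i) (sec T)^-1.
have mS i : measurable (S i) by exact: measurable_capcone.
have mU := @measurable_eball R d.+1 0 1.
have m0 := measurable_row_set1 (0 : V).
pose B := eball (0 : V) 1 `\` [set 0].
have mB : measurable B by exact: measurableD.
have vB : vol B = beta%:E.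
  have v1 : vol (eball (0 : V) 1) = beta%:E by rewrite vol_eball// expr1n mul1r.
  apply/eqP; rewrite eq_le; apply/andP; split; rewrite -v1.
    by apply: le_measure; rewrite ?inE//; exact: subDsetl.
  apply: (@le_trans _ _ (vol (B `|` [set (0 : V)]))).
    apply: le_measure; rewrite ?inE//; first exact: measurableU.
    by move=> v Bv; have [->|/eqP vn] := eqVneq v 0; [right|left].
  apply: le_trans (measureU2 _ mB m0) _.
  by rewrite [X in (_ + X)%E](_ : _ = 0%E) ?adde0//; exact: vol_set1.
have k0 : 0 <= #|I|%:R * (ccap * T ^+ d / beta).
  by rewrite mulr_ge0// divr_ge0 ?(ltW b0)// mulr_ge0 ?(ltW g0)// exprn_ge0// ltW.
have [||v [v1 vn0] hv] := @exists_few_indic _ _ R (@vol R d.+1) I S B _ k0 mB mS.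
- by rewrite /= vB lte_fin b0 ltry.
- rewrite /= vB -EFinM -!mulrA mulVf ?gt_eqF// mulr1.
  apply: (@le_trans _ _ (\sum_(i : I) (gam R d * (T ^+ d * kappa R d))%:E)%E).
    apply: lee_sum => i _; apply: le_trans (vol_capcone_le (x1 i) T0).
    by apply: le_measure; rewrite ?inE; [exact: measurableI|exact: mS|exact: subIsetl].
  rewrite sumEFin sumr_const -[X in (X%:E <= _)%E]mulr_natl lee_fin.
  by rewrite le_eqVlt; apply/orP; left; apply/eqP; ring.
have vp : 0 < enorm v.
  by rewrite lt0r enorm_ge0 andbT; apply/eqP => /enorm_eq0.
exists ((enorm v)^-1 *: v); first by rewrite enormZ gtr0_norm ?invr_gt0// mulVf// gt_eqF.
apply: le_trans hv; rewrite -sum1_card natr_sum big_mkcond /=.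
apply: ler_sum => i _; rewrite indicE; case: ifPn => // h.
rewrite mem_set//; split; first by move: v1; rewrite /eball /= subr0.
move: h; rewrite inE /= innerZl (innerC v) mulrC => h.
by rewrite -ler_pdivlMr// mulrC.
Qed.

Lemma rtailB (u v : V) : rtail (u - v) = rtail u - rtail v.
Proof. by apply/rowP => j; rewrite !mxE. Qed.

(** Reflect [y] to the pole and project. A covering point is within chord [t] of the point it
    covers, and undoing the projection stretches this by at most [b], by [gno_dist_ge] with
    [e = T]. *)
Lemma gnomonic_cover (I : finType) (x : I -> V) (y : V) (t T b : R) :
  0 < t -> 4 * t <= T -> T <= 1 -> 0 < b -> 1 + T ^+ 2 <= b ^+ 2 * (1 - T ^+ 2) ->
  enorm y = 1 -> (forall i, enorm (x i) = 1) ->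
  (forall z, enorm z = 1 -> exists i, (sec t)^-1 <= inner z (x i)) ->
  exists g : {i | (sec T)^-1 <= inner y (x i)} -> 'rV[R]_d,
    eball 0 (T - 4 * t) `<=` \bigcup_k eball (g k) (b * t).
Proof.
move=> t0 tT T1 b0 hb y1 x1 cov.
pose x' i := householder y (x i).
have x'1 i : enorm (x' i) = 1 by rewrite enorm_householder.
exists (fun k => (x' (val k) 0 0)^-1 *: rtail (x' (val k))) => h.
rewrite /eball /= subr0 => hT; have h0 := enorm_ge0 h.
have [i hi] := cov (householder y (gno h)) (etrans (enorm_householder _ _) (enorm_gno h)).
have {}hi : (sec t)^-1 <= inner (gno h) (x' i).
  by rewrite -(inner_householder y) /x' householderK.
have dist := chord_le_of_inner (enorm_gno h) (x'1 i) (ltW t0) hi.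
set c := (sec (enorm h))^-1.
have c2 : 1 / 2 <= c.
  rewrite /c div1r lef_pV2 ?posrE ?sec_gt0//.
  by apply: (le_trans (sec_le h0)); lra.
have d0' : gno h 0 0 - x' i 0 0 <= t.
  have -> : gno h 0 0 - x' i 0 0 = (gno h - x' i) 0 0 by rewrite [RHS]mxE [X in _ = _ + X]mxE.
  by apply: le_trans dist; apply: le_trans (ler_norm _) (coord_le_enorm _ _).
have x0 : c - t <= x' i 0 0 by move: d0'; rewrite gno0 -/c; lra.
have xp : 0 < x' i 0 0 by lra.
have xt : enorm (rtail (x' i)) <= c * enorm h + t.
  have -> : rtail (x' i) = rtail (gno h) - rtail (gno h - x' i).
    by rewrite rtailB opprB addrC subrK.
  rewrite (le_trans (enormD _ _))// enormN rtail_gno enormZ gtr0_norm ?invr_gt0 ?sec_gt0//.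
  by rewrite lerD2l (le_trans (enorm_rtail_le _)).
have T0 : 0 <= T by lra.
have xT : enorm ((x' i 0 0)^-1 *: rtail (x' i)) <= T.
  rewrite enormZ gtr0_norm ?invr_gt0// mulrC ler_pdivrMr// (le_trans xt)//.
  (* Origin of the margin [4 * t]: as [c >= 1 / 2] and [T <= 1], [4 * t * c >= 2 * t >= t + T * t],
     which pays for the error [t] in both the height and the tail. *)
  apply: (@le_trans _ _ (T * (c - t))); last by rewrite ler_wpM2l.
  have : 0 <= (T - 4 * t - enorm h) * c by rewrite mulr_ge0//; lra.
  have : 0 <= t * (c - 1 / 2) by rewrite mulr_ge0//; lra.
  have : 0 <= t * (1 - T) by rewrite mulr_ge0//; lra.
  by lra.
have Ji : (sec T)^-1 <= inner y (x i).
  by rewrite (inner_householder_pole _ y1) -/(x' i) -[X in X <= _]mulr1 -(x'1 i) gnomonicE.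
exists (exist _ i Ji) => //=.
have := gno_dist_ge T0 (le_trans hT _) xT; rewrite gnoK//.
have -> : T - 4 * t <= T by lra.
move=> /(_ isT) H.
have T2 : 0 < 1 - T ^+ 2.
  by have := sqr_ge0 T; have := exprn_gt0 2 b0; nra.
rewrite -(@ler_pXn2r _ 2)// ?nnegrE ?enorm_ge0 ?mulr_ge0 ?(ltW b0) ?(ltW t0)//.
rewrite -(ler_pM2l T2) (le_trans H)//.
have s : enorm (gno h - x' i) ^+ 2 <= t ^+ 2 by rewrite lerXn2r// nnegrE ?enorm_ge0 ?ltW.
apply: (@le_trans _ _ ((1 + T ^+ 2) * t ^+ 2)).
  by rewrite ler_wpM2l// addr_ge0// sqr_ge0.
rewrite (_ : (1 - T ^+ 2) * _ = b ^+ 2 * (1 - T ^+ 2) * t ^+ 2); last by ring.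
by rewrite ler_wpM2r// sqr_ge0.
Qed.

Lemma scale_cover (I : Type) (g : I -> 'rV[R]_d) (r s : R) : 0 < s ->
  eball 0 r `<=` \bigcup_k eball (g k) s ->
  eball 0 (r / s) `<=` \bigcup_k eball (s^-1 *: g k) 1.
Proof.
move=> s0 cov v vr; have [|k _ kv] := cov (s *: v).
  by move: vr; rewrite /eball /= !subr0 enormZ gtr0_norm// ler_pdivlMr// mulrC.
exists k => //; move: kv; rewrite /eball /=.
have -> : v - s^-1 *: g k = s^-1 *: (s *: v - g k).
  by rewrite scalerBr scalerA mulVf ?gt_eqF// scale1r.
by rewrite enormZ gtr0_norm ?invr_gt0// mulrC ler_pdivrMr// mul1r.
Qed.

Lemma small_root_eventually (C tau : R) : 0 < C -> 0 < tau ->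
  exists N, (0 < N)%N /\ forall n t, (N <= n)%N -> 0 <= t -> t ^+ d = C / n%:R -> t <= tau.
Proof.
move=> C0 tau0; exists (Num.truncn (C / tau ^+ d)).+1; split=> // n t Nn t0 tE.
rewrite leNgt; apply/negP => taut.
have : tau ^+ d < t ^+ d by rewrite ltr_pXn2r// nnegrE ltW.
have n0 : 0 < n%:R :> R by rewrite ltr0n (leq_ltn_trans _ Nn).
rewrite tE ltr_pdivlMr// mulrC -ltr_pdivlMr ?exprn_gt0//.
by apply/negP; rewrite -leNgt ltW// (lt_le_trans (truncnS_gt _))// ler_nat.
Qed.

(** The radius [t] makes [ccap * t ^+ d / beta] equal to [c * L / n]. The extra [c] pays for the
    lower bound on the volume of a cap cone, so caps of radius [t] have [sigma] at least [L / n]; a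
    configuration with all empty caps below [L / n] meets each of them. *)
Lemma disp_lower (L : R) : 0 < L ->
  (forall N, exists2 n, (N <= n)%N & (n%:R%:E * disp R n d < L%:E)%E) ->
  (covering_density R d <= L%:E)%E.
Proof.
move=> L0 freq; have b0 := kappa_gt0 R d.+1; have g0 := ccap_gt0.
(* One factor [c] comes from the choice of [t], one from replacing [rho] by [rho - 4], and [d] from
   stretching the radius by [c]. *)
apply: (@lee_mul_gt1 _ d.+2); first exact: ltW.
move=> c c1; have c0 : 0 < c by rewrite (lt_trans ltr01).
have [e e0 he] := expr_near1 d.+1 c1.
apply: covering_density_le_of_balls => //.
  by rewrite mulr_ge0 ?exprn_ge0// ltW.
move=> M; have [M' M'4 hM'] := @shrink_near1 _ d c 4 c1 (ler0n _ 4).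
pose rho := Num.max M' (M * c + 4).
have M'rho : M' <= rho by rewrite le_max lexx.
have Mrho : M * c + 4 <= rho by rewrite le_max lexx orbT.
have rho4 : 4 < rho by exact: lt_le_trans M'rho.
have rho0 : 0 < rho by lra.
(* For [T <= 1], [T <= tau0] gives [T ^+ 2 * (1 + c ^+ 2) <= c ^+ 2 - 1], the stretching condition
   of [gnomonic_cover] with [b = c]. *)
pose tau0 := (c ^+ 2 - 1) / (1 + c ^+ 2).
have c21 : 0 < c ^+ 2 - 1 by rewrite expr2; nra.
have tau00 : 0 < tau0 by rewrite divr_gt0// addr_gt0// exprn_gt0.
pose tau := Num.min e (Num.min 1 tau0 / rho).
have tau_gt0 : 0 < tau by rewrite lt_min e0 divr_gt0// lt_min ltr01.
have C0 : 0 < c * L * beta / ccap by rewrite divr_gt0// !mulr_gt0.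
have [N [N0 hN]] := small_root_eventually C0 tau_gt0.
have [n Nn hn] := freq N.
have n0 : 0 < n%:R :> R by rewrite ltr0n (leq_trans N0).
have [t t0 tE] := expr_root (divr_gt0 C0 n0).
have := hN _ _ Nn (ltW t0) tE; rewrite le_min ler_pdivlMr// le_min.
move=> /andP[te /andP[T1 Ttau]].
pose T := t * rho; have T0 : 0 < T by rewrite mulr_gt0.
have tT : 4 * t <= T by rewrite mulrC /T ler_pM2l// ltW.
have hT : 1 + T ^+ 2 <= c ^+ 2 * (1 - T ^+ 2).
  have : T * (1 + c ^+ 2) <= c ^+ 2 - 1 by rewrite -ler_pdivlMr// addr_gt0// exprn_gt0.
  have : 0 <= (1 - T) * T * (1 + c ^+ 2).
    apply: mulr_ge0; first by apply: mulr_ge0; [rewrite subr_ge0|exact: ltW].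
    by apply: addr_ge0 => //; exact: sqr_ge0.
  by lra.
move: hn; rewrite -lte_pdivlMl// -EFinM mulrC => /ereal_inf_lt[_ [x x1 <-] hx].
have cov z : enorm z = 1 -> exists i, (sec t)^-1 <= inner z (x i).
  move=> z1; apply: contrapT => /forallNP hz.
  have s0 := sec_gt0 t; have s1 := sec_ge1 t.
  have si : -1 <= (sec t)^-1 <= 1.
    have : 0 < (sec t)^-1 by rewrite invr_gt0.
    by rewrite invf_le1// s1 andbT; lra.
  pose phi := acos (sec t)^-1.
  have phi1 : 0 <= phi <= pi by rewrite /phi acos_ge0// acos_lepi.
  have : (sigma (cap z phi) < (L / n%:R)%:E)%E.
    apply: le_lt_trans hx; apply: ereal_sup_ubound; exists (cap z phi) => //.
    split; first by exists z, phi.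
    apply/seteqP; split => // v [[_ hc] [i _ xv]]; apply: (hz i).
    by move: hc; rewrite -xv (le_acos (sphere_bound z1 (x1 i)) phi1) /phi acosK// in_itv.
  apply/negP; rewrite -leNgt sigma_cap// /phi acosK ?in_itv//.
  rewrite lee_pdivlMl//; apply: le_trans (vol_capcone_ge z1 t0).
  rewrite -EFinM lee_fin exprVn [leRHS]mulrC ler_pdivlMr ?exprn_gt0//.
  have -> : gam R d * (t ^+ d * kappa R d) = beta * (L / n%:R) * c.
    rewrite tE; field.
    by rewrite !gt_eqF ?gam_gt0 ?kappa_gt0.
  rewrite ler_wpM2l ?mulr_ge0 ?divr_ge0 ?(ltW b0) ?(ltW L0) ?(ltW n0)//.
  by apply: he; rewrite sec_ge0 (le_trans (sec_le (ltW t0)))// lerD2l.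
have [y y1 hy] := few_in_cap T0 x1.
have [g hg] := gnomonic_cover t0 tT T1 c0 hT y1 x1 cov.
have ct0 : 0 < c * t by rewrite mulr_gt0.
have := scale_cover ct0 hg.
have -> : (T - 4 * t) / (c * t) = (rho - 4) / c by rewrite /T; field; rewrite !gt_eqF.
move=> hcov; exists ((rho - 4) / c); first by rewrite ler_pdivlMr//; lra.
exists {i | (sec T)^-1 <= inner y (x i)}, (fun k => (c * t)^-1 *: g k); split => //.
rewrite card_sig (le_trans hy)// card_ord.
have -> : n%:R * (ccap * T ^+ d / beta) = c * L * rho ^+ d.
  rewrite /T exprMn tE; field.
  by rewrite !gt_eqF ?gam_gt0 ?kappa_gt0.
have := hM' _ M'rho; rewrite !expr_div_n ler_pdivrMr ?exprn_gt0 ?subr_gt0// => h.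
rewrite mulrA ler_pdivlMr ?exprn_gt0//.
rewrite (_ : c ^+ d.+2 * L * _ = c * L * (c * (rho - 4) ^+ d) * c ^+ d); last first.
  by rewrite !exprS; ring.
by rewrite !ler_wpM2r ?ler_wpM2l ?mulr_ge0 ?exprn_ge0 ?(ltW c0) ?(ltW L0).
Qed.

End sphere_lower.

(** * The upper bound *)

Lemma measure_bigsetU_le d (T : measurableType d) (R : realType)
    (mu : {measure set T -> \bar R}) (I : Type) (r : seq I) (F : I -> set T) :
  (forall i, measurable (F i)) ->
  (mu (\big[setU/set0]_(i <- r) F i) <= \sum_(i <- r) mu (F i))%E.
Proof.
move=> mF; elim: r => [|i r IH]; first by rewrite !big_nil measure0.
rewrite !big_cons; apply: le_trans (measureU2 _ (mF i) _) _.
  exact: bigsetU_measurable.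
exact: leeD2l.
Qed.

Section sphere_net.
Context (R : realType) (d : nat).
Local Notation V := 'rV[R]_d.+1.

Lemma sphere_net (s : R) : 0 < s -> exists zs : seq V,
  (forall z, z \in zs -> enorm z = 1) /\
  (forall y, enorm y = 1 -> exists2 z, z \in zs & enorm (z - y) <= s).
Proof.
(* Two points of a cell of side [A] are at distance at most [2 * d.+1 * A], which is [s]. One point
   of the sphere is kept per cell that meets it. *)
move=> s0; pose A := s / (2 * d.+1%:R).
have D0 : 0 < 2 * d.+1%:R :> R by rewrite mulr_gt0.
have A0 : 0 < A by rewrite divr_gt0.
have /choice[p pE] : forall w, exists z : V, enorm z = 1 /\
    ((exists2 v, cell A w v & enorm v = 1) -> cell A w z).
  move=> w; have [[v wv v1]|h] := pselect (exists2 v, cell A w v & enorm v = 1).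
    by exists v.
  by exists pole; split => //; exact: enorm_pole.
have fin := @finite_touching R d.+1 A A0 1.
exists [seq p w | w <- fset_set (touching A 1)]; split.
  by move=> _ /mapP[w _ ->]; have [] := pE w.
move=> y y1; have [w wy] := cell_ex A0 y.
exists (p w).
  apply: map_f; rewrite in_fset_set//; apply/mem_set.
  by exists y => //; rewrite y1.
have [_ h] := pE w; apply: le_trans (cell_dist A0 (h _) wy) _; first by exists y.
by rewrite mulrA /A mulrC divfK// gt_eqF.
Qed.

End sphere_net.

Section partition.
Context (R : realType) (d K : nat).
Local Notation V := 'rV[R]_d.+1.
Variables (z : 'I_K -> V) (T1 T T2 : R).
Hypotheses (z1 : forall i, enorm (z i) = 1) (T1_gt0 : 0 < T1) (T1T : T1 < T) (TT2 : T < T2).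
Local Notation beta := (kappa R d.+1).
Local Notation c1 := (sec T1)^-1.
Local Notation c := (sec T)^-1.
Local Notation c2 := (sec T2)^-1.

Lemma ltr_sec (s t : R) : 0 <= s -> s < t -> sec s < sec t.
Proof.
move=> s0 st; rewrite -(@ltr_pXn2r _ 2)// ?nnegrE ?sec_ge0// !sec_sqr ltrD2l.
by rewrite ltr_pXn2r// nnegrE (le_trans s0)// ltW.
Qed.

Let T_gt0 : 0 < T. Proof. exact: lt_trans T1T. Qed.
Let T2_gt0 : 0 < T2. Proof. exact: lt_trans TT2. Qed.

Lemma c2_lt_c : c2 < c.
Proof. by rewrite ltf_pV2 ?posrE ?sec_gt0// ltr_sec// ltW. Qed.

Lemma c_lt_c1 : c < c1.
Proof. by rewrite ltf_pV2 ?posrE ?sec_gt0// ltr_sec// ltW. Qed.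

(* The part of the cap of [z j] outside the earlier caps, as a cone; [lo] and
   [hi] relax the two boundary thresholds. *)
Definition sector (lo hi : R) (j : 'I_K) : set V :=
  [set v | lo * enorm v <= inner (z j) v /\
     forall i : 'I_K, (i < j)%N -> inner (z i) v < hi * enorm v].

Lemma sectorZ lo hi j (a : R) v : 0 < a -> sector lo hi j (a *: v) <-> sector lo hi j v.
Proof.
move=> a0; rewrite /sector /= enormZ gtr0_norm// innerZr mulrCA ler_pM2l//.
split=> -[-> h]; split=> // i ij; have := h i ij; by rewrite innerZr mulrCA ltr_pM2l.
Qed.

Lemma measurable_sector lo hi j : measurable (sector lo hi j).
Proof.
have mn : measurable_fun [set: V] (@enorm R d.+1) by exact: measurable_enorm.
apply: measurableI.
  by apply: measurable_le; [exact: measurable_funM|exact: measurable_inner].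
suff : measurable (\bigcap_(i in [set i : 'I_K | (i < j)%N])
    [set v : V | inner (z i) v < hi * enorm v]) by [].
apply: fin_bigcap_measurable => // i _.
by apply: measurable_lt; [exact: measurable_inner|exact: measurable_funM].
Qed.

Let ball1 := eball (0 : V) 1.
Let mball1 : measurable ball1. Proof. exact: measurable_eball. Qed.

(** The cone over the annulus between radii [T1] and [T2] about [z i], where relaxing the thresholds
    matters. *)
Definition shell (i : 'I_K) : set V :=
  [set v | c2 * enorm v <= inner (z i) v] `&` [set v | inner (z i) v < c1 * enorm v].

Lemma measurable_shell i : measurable (shell i).
Proof.
have mn : measurable_fun [set: V] (@enorm R d.+1) by exact: measurable_enorm.
apply: measurableI.
  by apply: measurable_le; [exact: measurable_funM|exact: measurable_inner].
by apply: measurable_lt; [exact: measurable_inner|exact: measurable_funM].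
Qed.

Lemma vol_shell i : (vol (shell i `&` ball1) <=
  (gam R d * kappa R d * (T2 ^+ d - T1 ^+ d))%:E)%E.
Proof.
pose E := eball (0 : 'rV[R]_d) T2 `\` eball 0 T1.
have mE : measurable E by apply: measurableD; exact: measurable_eball.
have mp : measurable (pyramid 1 E) by exact: measurable_pyramid.
have vE : vol E = (kappa R d * (T2 ^+ d - T1 ^+ d))%:E.
  have m1 := @measurable_eball R d 0 T1; have m2 := @measurable_eball R d 0 T2.
  have v1 : vol (eball (0 : 'rV[R]_d) T1) = (T1 ^+ d * kappa R d)%:E by rewrite vol_eball.
  have v2 : vol (eball (0 : 'rV[R]_d) T2) = (T2 ^+ d * kappa R d)%:E by rewrite vol_eball.
  rewrite /E measureD//; last by rewrite /= v2 ltry.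
  rewrite (_ : _ `&` _ = eball 0 T1); last first.
    apply/setIidPr => v; rewrite /eball /= => h; rewrite (le_trans h)//.
    by rewrite ltW// (lt_trans T1T).
  by rewrite /= v1 v2 -EFinB; congr EFin; ring.
have -> : ((gam R d * kappa R d * (T2 ^+ d - T1 ^+ d))%:E =
    vol [set v | pyramid 1 E (householder (z i) v)])%E.
  by rewrite vol_householder// vol_pyramid// expr1n mul1r vE -EFinM mulrA.
apply: le_measure; rewrite ?inE.
- by apply: measurableI => //; exact: measurable_shell.
- by apply: (measurable_preimage _ mp); exact: measurable_householder.
move=> v [[]]; rewrite /ball1 /eball /= subr0 (inner_householder_pole _ (z1 i)) => h2 h1 v1.
rewrite -(enorm_householder (z i) v) in h1 h2 v1; move: (householder _ _) h1 h2 v1 => w h1 h2 w1.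
have wn0 : 0 < enorm w.
  rewrite lt0r enorm_ge0 andbT; apply/eqP => w0.
  by move: h1 h2; rewrite w0 !mulr0; lra.
have w0 : 0 < w 0 0 by apply: lt_le_trans h2; rewrite mulr_gt0 ?invr_gt0 ?sec_gt0.
split; first by rewrite w0 (le_trans _ w1)// (le_trans (ler_norm _))// coord_le_enorm.
split; rewrite /eball /= subr0; first by rewrite -gnomonicE// ltW.
by apply/negP; rewrite -(gnomonicE w0 (ltW T1_gt0)) -ltNge.
Qed.

(** A point gained by relaxing is gained either at the boundary of its own cap or at that of an
    earlier one. *)
Lemma sector_sub j :
  sector c2 c1 j `<=` sector c c j `|` \bigcup_(i in [set: 'I_K]) shell i.
Proof.
move=> v [h2 h1]; have n0 := enorm_ge0 v; have c12 := c_lt_c1; have c02 := c2_lt_c.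
have [hc|hc] := leP (c * enorm v) (inner (z j) v); last first.
  right; exists j => //; split => //=; apply: (lt_le_trans hc).
  by rewrite ler_wpM2r// ltW.
have [ha|] := pselect (forall i : 'I_K, (i < j)%N -> inner (z i) v < c * enorm v).
  by left.
move=> /existsNP[i /not_implyP[ij /negP]]; rewrite -leNgt => hi.
right; exists i => //; split => /=; last exact: h1.
by apply: le_trans hi; rewrite ler_wpM2r// ltW.
Qed.

Lemma sum_vol_sector_exact : (\sum_j vol (sector c c j `&` ball1) <= beta%:E)%E.
Proof.
have -> : beta%:E = vol ball1 by rewrite vol_eball// expr1n mul1r.
rewrite -(measure_bigsetU_ord (@vol R d.+1) xpredT) /=; last 2 first.
- by move=> j; apply: measurableI => //; exact: measurable_sector.
- move=> i j _ _ [v [[[i1 i2] _] [[j1 j2] _]]].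
  apply/val_inj/eqP; case: ltngtP => // ij.
    by have := j2 _ ij; rewrite ltNge i1.
  by have := i2 _ ij; rewrite ltNge j1.
apply: le_measure; rewrite ?inE//.
  by apply: bigsetU_measurable => j _; apply: measurableI => //; exact: measurable_sector.
by move=> v; rewrite -bigcup_seq => -[j _ []].
Qed.

(** The exact sectors are disjoint, and each of the [K] relaxed ones is charged all [K] shells. This
    crude count suffices because [T1] and [T2] are chosen after [K]. *)
Lemma sum_vol_sector : (\sum_j vol (sector c2 c1 j `&` ball1) <=
  (beta + (K * K)%:R * (gam R d * kappa R d * (T2 ^+ d - T1 ^+ d)))%:E)%E.
Proof.
have H j : (vol (sector c2 c1 j `&` ball1) <= vol (sector c c j `&` ball1) +
    (K%:R * (gam R d * kappa R d * (T2 ^+ d - T1 ^+ d)))%:E)%E.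
  have mS := measurable_sector.
  have mI i : measurable (shell i `&` ball1).
    by apply: measurableI => //; exact: measurable_shell.
  have mU : measurable (\big[setU/set0]_i (shell i `&` ball1)) by exact: bigsetU_measurable.
  apply: (@le_trans _ _ (vol ((sector c c j `&` ball1) `|`
      \big[setU/set0]_i (shell i `&` ball1)))).
    apply: le_measure; rewrite ?inE.
    - exact: measurableI.
    - by apply: measurableU => //; exact: measurableI.
    move=> v [/sector_sub[hv|[i _ iv]] vb]; first by left.
    by right; rewrite -bigcup_seq; exists i => //=; rewrite mem_index_enum.
  apply: le_trans (measureU2 _ _ mU) _; first exact: measurableI.
  apply: leeD2l; apply: le_trans (measure_bigsetU_le _ _ mI) _.
  apply: (@le_trans _ _ (\sum_(i : 'I_K) (gam R d * kappa R d * (T2 ^+ d - T1 ^+ d))%:E)%E).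
    by apply: lee_sum => i _; exact: vol_shell.
  by rewrite sumEFin sumr_const card_ord mulr_natl.
apply: (@le_trans _ _ (\sum_j (vol (sector c c j `&` ball1) +
    (K%:R * (gam R d * kappa R d * (T2 ^+ d - T1 ^+ d)))%:E))%E).
  by apply: lee_sum.
rewrite big_split /= EFinD; apply: leeD; first exact: sum_vol_sector_exact.
by rewrite sumEFin sumr_const card_ord lee_fin natrM -[leRHS]mulrA [leRHS]mulr_natl.
Qed.

Definition chart (j : 'I_K) : set 'rV[R]_d :=
  [set g | sector c2 c1 j (householder (z j) (rcons0 1 g))].

Lemma measurable_chart j : measurable (chart j).
Proof.
apply: (measurable_preimage _ (measurable_sector c2 c1 j)).
apply: (measurableT_comp (measurable_householder (z j))).
exact: measurable_rcons0.
Qed.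

Lemma chart_bound j g : chart j g -> enorm g <= T2.
Proof.
move=> [h _]; move: h; rewrite (inner_householder_pole _ (z1 j)) householderK enorm_householder.
have g0 : 0 < rcons0 1 g 0 0 by rewrite rcons0_0.
by rewrite (gnomonicE g0 (ltW T2_gt0)) rcons0_0 rcons0K invr1 scale1r.
Qed.

(** The pyramid of height [c2] over the chart, reflected back, lies in the sector and in the unit
    ball, sectors being homogeneous. *)
Lemma vol_chart j : (vol (chart j) <=
  (sec T2 ^+ d.+1 / gam R d)%:E * vol (sector c2 c1 j `&` ball1))%E.
Proof.
have mS : measurable (sector c2 c1 j `&` ball1).
  by apply: measurableI => //; exact: measurable_sector.
have s0 := sec_gt0 T2; have g0 := gam_gt0 R d.
have -> : vol (chart j) = ((sec T2 ^+ d.+1 / gam R d)%:E * vol (pyramid c2 (chart j)))%E.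
  rewrite vol_pyramid ?invr_gt0//; last exact: measurable_chart.
  rewrite muleA -EFinM (_ : _ * _ = 1) ?mul1e//.
  by rewrite exprVn; field; rewrite !gt_eqF// exprn_gt0.
apply: lee_wpmul2l; first by rewrite lee_fin divr_ge0 ?exprn_ge0 ?sec_ge0// ltW.
rewrite -(vol_householder (z j) mS); apply: le_measure; rewrite ?inE.
- by apply: measurable_pyramid; exact: measurable_chart.
- by apply: (measurable_preimage _ mS); exact: measurable_householder.
move=> v vp; have [v0 [v1 _]] := pyramid_sub_ball (ltW T2_gt0) (@chart_bound j) vp.
split; last by rewrite /ball1 /eball /= subr0 enorm_householder.
case: vp => _ vc; rewrite (rcons1_homogeneous v0) householderZ; apply/sectorZ => //.
Qed.

Section points.
Variables (x : nat -> 'rV[R]_d) (l m t : R).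
Hypotheses (xcov : \bigcup_i eball (x i) 1 = setT) (xl : has_covering_density x l%:E).
Hypotheses (lm : l < m) (m0 : 0 < m) (t0 : 0 < t).
Hypothesis net : forall y, enorm y = 1 -> exists j, c <= inner (z j) y.
Hypotheses (tc2 : t / sec t <= c - c2) (tc1 : t / sec t <= c1 - c).
(** The scale of the Euclidean covering: by [inner_ge_of_chord], points at chord distance [s] share
    a cap of radius [t]. Moving a unit vector by [s] changes its inner products with the [z k] by at
    most [s], which [tc1] and [tc2] keep within the margins. *)
Let s := t / sec t.

Let s_gt0 : 0 < s. Proof. by rewrite divr_gt0// sec_gt0. Qed.

Lemma chart_points j : exists us : 'rV[R]_d * seq nat,
  (forall i, chart j (s *: (x i + us.1)) -> i \in us.2) /\
  ((size us.2)%:R%:E <= (m / kappa R d / s ^+ d * (sec T2 ^+ d.+1 / gam R d))%:E *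
     vol (sector c2 c1 j `&` ball1))%E.
Proof.
pose W := [set h | chart j (s *: h + 0)].
have mW : measurable W.
  apply: (measurable_preimage _ (measurable_chart j)).
  by apply: measurable_rowD => //; exact: measurable_rowZ.
have WD v : W v -> enorm v <= T2 / s.
  move/chart_bound; rewrite addr0 enormZ gtr0_norm// mulrC.
  by rewrite ler_pdivlMr.
have D0 : 0 <= T2 / s by rewrite divr_ge0// ltW.
have [u [S [hS sS]]] := few_centers_in xl lm m0 D0 mW WD.
exists (u, S); split => [i /=|]; first by rewrite -[_ *: _]addr0; exact: hS.
apply: (le_trans sS).
rewrite /W (vol_affine 0 s_gt0 (measurable_chart j)) muleA -EFinM.
rewrite [X in (_ <= X * _)%E]EFinM -[X in (_ <= X)%E]muleA.
apply: lee_pmul => //; last exact: vol_chart.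
by rewrite lee_fin mulr_ge0// ?invr_ge0 ?exprn_ge0 ?ltW// divr_gt0// kappa_gt0.
Qed.

(** Take the first [j] whose cap contains [y]. Some point of the scaled covering is within [s] of
    the projection of [y], hence within chord [s] of [y] since [gno] does not increase distances; it
    is in the relaxed sector and so was kept. *)
Lemma sphere_points : exists P : seq V,
  [/\ forall p, p \in P -> enorm p = 1,
      forall y, enorm y = 1 -> exists2 p, p \in P & (sec t)^-1 <= inner y p &
      (size P)%:R <= m / kappa R d / s ^+ d * (sec T2 ^+ d.+1 / gam R d) *
        (beta + (K * K)%:R * (gam R d * kappa R d * (T2 ^+ d - T1 ^+ d)))].
Proof.
have /choice[us usP] := chart_points.
pose pt j i := householder (z j) (gno (s *: (x i + (us j).1))).
exists (flatten [seq [seq pt j i | i <- (us j).2] | j <- enum 'I_K]); split.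
- move=> p /flattenP[_ /mapP[j _ ->] /mapP[i _ ->]].
  by rewrite enorm_householder enorm_gno.
- move=> y y1.
  have [j0 j0y] := net y1.
  pose Q (j : 'I_K) := c <= inner (z j) y.
  have [j jy jmin] : exists2 j, Q j & forall i : 'I_K, (i < j)%N -> ~~ Q i.
    have [j Qj hj] := @arg_minnP _ j0 Q (fun j => j : nat) j0y.
    by exists j => // i ij; apply/negP => /hj; rewrite leqNgt ij.
  pose w := householder (z j) y.
  have w1 : enorm w = 1 by rewrite enorm_householder.
  have w0 : 0 < w 0 0.
    by rewrite -(inner_householder_pole _ (z1 j)) (lt_le_trans _ jy)// invr_gt0 sec_gt0.
  pose g := (w 0 0)^-1 *: rtail w.
  have gw : gno g = w by exact: gnoK.
  have [i _ hi] : (\bigcup_i eball (x i) 1) (s^-1 *: g - (us j).1) by rewrite xcov.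
  pose h := s *: (x i + (us j).1).
  have hg : enorm (h - g) <= s.
    have -> : h - g = s *: (x i - (s^-1 *: g - (us j).1)).
      by rewrite opprB addrA scalerBr scalerA mulfV ?gt_eqF// scale1r.
    by rewrite enormZ gtr0_norm// -[leRHS]mulr1 ler_wpM2l ?(ltW s_gt0)// edistC.
  have py : enorm (pt j i - y) <= s.
    apply: le_trans hg; apply: le_trans (gno_dist_le _ _).
    rewrite gw /pt -(householderK (z j) y) -/w -/h.
    by rewrite -scaleN1r -householderZ -householderD scaleN1r enorm_householder.
  have p1 : enorm (pt j i) = 1 by rewrite enorm_householder enorm_gno.
  have diff k : `|inner (z k) (pt j i) - inner (z k) y| <= s.
    rewrite -innerNr -innerDr ler_norml; apply/andP; split.
      have := inner_le_enorm (- z k) (pt j i - y); rewrite innerNl enormN z1 mul1r; lra.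
    by have := inner_le_enorm (z k) (pt j i - y); rewrite z1 mul1r; lra.
  exists (pt j i).
    apply/flattenP; exists [seq pt j i | i <- (us j).2]; first by apply/mapP; exists j; rewrite ?mem_enum.
    apply: map_f; apply: (usP j).1; rewrite /chart /mkset -/h.
    have := @sectorZ c2 c1 j (sec (enorm h))^-1 (householder (z j) (rcons0 1 h)).
    rewrite invr_gt0 sec_gt0 => /(_ isT)[H _]; apply: H.
    rewrite -householderZ -/(gno h) -/(pt j i); split.
      rewrite p1 mulr1; have := diff j; rewrite ler_norml; move: jy; rewrite /Q.
      by move: tc2; rewrite -/s; lra.
    move=> k kj; rewrite p1 mulr1; have := diff k; rewrite ler_norml.
    have := jmin k kj; rewrite /Q -ltNge; move: tc1; rewrite -/s; lra.
  rewrite innerC; apply: inner_ge_of_chord => //; first exact: ltW.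
  by rewrite mulrC -ler_pdivlMr ?sec_gt0.
- rewrite -lee_fin size_flatten /shape -map_comp sumnE big_map big_enum /= natr_sum -sumEFin.
  apply: (@le_trans _ _ (\sum_j (m / kappa R d / s ^+ d * (sec T2 ^+ d.+1 / gam R d))%:E *
     vol (sector c2 c1 j `&` ball1))%E).
    by apply: lee_sum => j _; rewrite size_map; exact: (usP j).2.
  rewrite -ge0_sume_distrr; last by move=> j _; exact: measure_ge0.
  rewrite [X in (_ <= X)%E]EFinM; apply: lee_wpmul2l; last exact: sum_vol_sector.
  have k0 := kappa_gt0 R d; have g0 := gam_gt0 R d; have s2 := sec_gt0 T2.
  by rewrite lee_fin ltW// !mulr_gt0 ?invr_gt0 ?exprn_gt0.
Qed.

End points.

End partition.

(** * Choice of the parameters and the limit *)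

Section main.
Context (R : realType) (d : nat).
Hypothesis d0 : (0 < d)%N.
Local Notation V := 'rV[R]_d.+1.
Local Notation beta := (kappa R d.+1).
Local Notation ccap := (gam R d * kappa R d).

Lemma radii_near (T q : R) : 0 < T -> 0 < q ->
  exists T1 T2, [/\ 0 < T1, T1 < T, T < T2, T2 <= 2 * T & T2 ^+ d - T1 ^+ d <= q * T ^+ d].
Proof.
move=> T0 q0; have c1 : 1 < 1 + q / 2 by rewrite ltrDl divr_gt0.
have [e e0 he] := expr_near1 d c1.
pose a := 1 + Num.min e 1.
have m0 : 0 < Num.min e 1 by rewrite lt_min e0 ltr01.
have a1 : 1 < a by rewrite ltrDl.
have a0 : 0 < a by rewrite (lt_trans ltr01).
have a2 : a <= 2 by rewrite /a -[2]/(1 + 1) lerD2l ge_min lexx orbT.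
have ad : a ^+ d <= 1 + q / 2 by apply: he; rewrite (ltW a0) lerD2l ge_min lexx.
exists (T / a), (a * T); split.
- by rewrite divr_gt0.
- by rewrite ltr_pdivrMr// ltr_pMr.
- by rewrite ltr_pMl.
- by rewrite ler_wpM2r// ltW.
have Td : 0 < T ^+ d by rewrite exprn_gt0.
have ad0 : 0 < a ^+ d by rewrite exprn_gt0.
rewrite expr_div_n exprMn [a ^+ d * _]mulrC -mulrBr mulrC ler_wpM2r ?(ltW Td)//.
(* From [(a ^+ d - 1) ^+ 2 >= 0]; then [a ^+ d - a ^- d <= 2 * (a ^+ d - 1) <= q]. *)
have : 2 - a ^+ d <= (a ^+ d)^-1.
  rewrite -(ler_pM2r ad0) mulVf ?gt_eqF//.
  by have := sqr_ge0 (a ^+ d - 1); nra.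
by lra.
Qed.

(** The order of choices matters: [T] fixes the net and thus [K], then [T1] and [T2] make the shells
    negligible against [K * K], and only then [t] is small against the margins. *)
Lemma disp_upper (x : nat -> 'rV[R]_d) (l L : R) :
  \bigcup_i eball (x i) 1 = setT -> has_covering_density x l%:E -> l < L -> 0 < L ->
  exists N, forall n, (N <= n)%N -> (n%:R%:E * disp R n d <= L%:E)%E.
Proof.
move=> xcov xl lL L0; have b0 := kappa_gt0 R d.+1; have g0 := ccap_gt0 R d.
have [m [m0 lm mL]] : exists m, [/\ 0 < m, l < m & m < L].
  exists (Num.max ((l + L) / 2) (L / 2)).
  rewrite !lt_max gt_max; split; last by apply/andP; split; lra.
    by apply/orP; right; lra.
  by apply/orP; left; lra.
(* Three losses: the curvature of the charts, the shells, and the scale [t / sec t] instead of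
   [t]. *)
have [b b1 hb] : exists2 b, 1 < b & m * b ^+ 3 <= L.
  have Lm : 1 < L / m by rewrite ltr_pdivlMr// mul1r.
  have [e e0 he] := expr_near1 3 Lm; exists (1 + e); first by rewrite ltrDl.
  by rewrite mulrC -ler_pdivlMr// he// lexx addr_ge0// ltW.
have bp : 0 < b by rewrite (lt_trans ltr01).
have [e1 e10 he1] := expr_near1 d.+1 b1.
pose T := e1 / 2; have T0 : 0 < T by rewrite divr_gt0.
have sT := sec_gt0 T.
have [zs [zs1 zsnet]] := @sphere_net R d (T / sec T) (divr_gt0 T0 sT).
pose K := size zs; pose z (j : 'I_K) : V := nth pole zs j.
have z1 j : enorm (z j) = 1 by apply: zs1; exact: mem_nth.
have net y : enorm y = 1 -> exists j, (sec T)^-1 <= inner (z j) y.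
  move=> y1; have [w wzs wy] := zsnet y y1.
  have wK : (index w zs < K)%N by rewrite index_mem.
  exists (Ordinal wK); rewrite /z /= nth_index//.
  apply: inner_ge_of_chord => //; [exact: zs1|exact: ltW|].
  by rewrite mulrC -ler_pdivlMr.
(* Chosen so that all shells together take at most [(b - 1) * beta]; the [+ 1] makes the divisor
   positive. *)
pose F := (K * K)%:R * ccap * T ^+ d + 1.
have F0 : 0 < F.
  by rewrite ltr_wpDl// mulr_ge0 ?exprn_ge0 ?(ltW T0)// mulr_ge0// ltW.
have q0 : 0 < (b - 1) * beta / F by rewrite divr_gt0// mulr_gt0// subr_gt0.
have [T1 [T2 [T1_0 T1T TT2 T22 hT]]] := radii_near T0 q0.
have T2_0 : 0 < T2 by rewrite (lt_trans T0).
have hsh : beta + (K * K)%:R * (ccap * (T2 ^+ d - T1 ^+ d)) <= b * beta.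
  have : (K * K)%:R * ccap * (T2 ^+ d - T1 ^+ d) <= (b - 1) * beta.
    apply: (@le_trans _ _ ((K * K)%:R * ccap * ((b - 1) * beta / F * T ^+ d))).
      by rewrite ler_wpM2l// mulr_ge0// ltW.
    have -> : (K * K)%:R * ccap * ((b - 1) * beta / F * T ^+ d) = (b - 1) * beta / F * (F - 1).
      by rewrite /F; ring.
    rewrite mulrAC ler_pdivrMr// ler_wpM2l//; last by lra.
    by rewrite mulr_ge0 ?(ltW b0)// subr_ge0 ltW.
  by rewrite mulrA; lra.
have hs2 : sec T2 ^+ d.+1 <= b.
  apply: he1; rewrite sec_ge0 (le_trans (sec_le (ltW T2_0)))// lerD2l (le_trans T22)//.
  by rewrite /T; lra.
have [e3 e30 he3] := expr_near1 d b1.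
have dc2 : 0 < (sec T)^-1 - (sec T2)^-1 by rewrite subr_gt0 (c2_lt_c T1_0 T1T TT2).
have dc1 : 0 < (sec T1)^-1 - (sec T)^-1 by rewrite subr_gt0 (c_lt_c1 T1_0 T1T).
pose tau := Num.min e3 (Num.min ((sec T)^-1 - (sec T2)^-1) ((sec T1)^-1 - (sec T)^-1)).
have tau0 : 0 < tau by rewrite !lt_min e30 dc2.
have C0 : 0 < L * beta / ccap by rewrite divr_gt0// mulr_gt0.
have [N [N0 hN]] := small_root_eventually d0 C0 tau0.
exists N => n Nn.
have n0 : 0 < n%:R :> R by rewrite ltr0n (leq_trans N0).
have [t t0 tE] := expr_root d0 (divr_gt0 C0 n0).
have := hN _ _ Nn (ltW t0) tE; rewrite !le_min => /and3P[te3 tc2 tc1].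
have st := sec_gt0 t.
have ts : t / sec t <= t by rewrite ler_pdivrMr// ler_peMr ?(ltW t0)// sec_ge1.
have [P [P1 Pnet Psize]] := sphere_points z1 T1_0 T1T TT2 xcov xl lm m0 t0 net
  (le_trans ts tc2) (le_trans ts tc1).
have td0 : 0 < t ^+ d by rewrite exprn_gt0.
have Pn : (size P <= n)%N.
  rewrite -(ler_nat R); apply: (le_trans Psize).
  have k0 := kappa_gt0 R d; have ga0 := gam_gt0 R d.
  apply: (@le_trans _ _ (m / kappa R d / (t / sec t) ^+ d * (b / gam R d) * (b * beta))).
    have h1 : 0 <= m / kappa R d / (t / sec t) ^+ d.
      by rewrite ltW// !divr_gt0// exprn_gt0// divr_gt0.
    apply: ler_pM => //.
    - by rewrite mulr_ge0// divr_ge0 ?exprn_ge0 ?sec_ge0// ltW.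
    - rewrite addr_ge0 ?(ltW b0)// !mulr_ge0 ?(ltW k0) ?(ltW ga0)// subr_ge0.
      by rewrite lerXn2r ?nnegrE ?ltW// (lt_trans T1T).
    - by rewrite ler_wpM2l// ler_wpM2r// invr_ge0 ltW.
  rewrite expr_div_n tE.
  have -> : m / kappa R d / (L * beta / ccap / n%:R / sec t ^+ d) * (b / gam R d) * (b * beta) =
      n%:R * (m * b ^+ 2 * sec t ^+ d) / L.
    by field; rewrite !gt_eqF// exprn_gt0.
  rewrite ler_pdivrMr// ler_wpM2l ?(ltW n0)//; apply: le_trans hb.
  rewrite [b ^+ 3]exprSr mulrA ler_wpM2l ?mulr_ge0 ?exprn_ge0 ?(ltW m0) ?(ltW bp)//.
  by apply: he3; rewrite sec_ge0 (le_trans (sec_le (ltW t0)))// lerD2l.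
rewrite -lee_pdivlMl//.
(* Missing points are filled in with the default [pole], which is on the sphere too. *)
pose X (i : 'I_n) : V := nth pole P i.
have X1 i : enorm (X i) = 1.
  rewrite /X; have [h|h] := ltnP i (size P); first by apply: P1; exact: mem_nth.
  by rewrite nth_default// enorm_pole.
apply: (le_trans (ereal_inf_lbound _)); first by exists X; [exact: X1|reflexivity].
apply: ge_ereal_sup => _ [_ [[y [phi [y1 phi1 ->]]] hC] <-].
rewrite sigma_cap// lee_pdivrMl//.
have hphi : (sec t)^-1 <= cos phi.
  rewrite leNgt; apply/negP => hlt.
  have [p pP hp] := Pnet y y1.
  have pn : (index p P < n)%N by rewrite (leq_trans _ Pn)// index_mem.
  have : (cap y phi `&` range X) p.
    split; last by exists (Ordinal pn) => //; rewrite /X /= nth_index.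
    split; first exact: P1.
    rewrite (le_acos (sphere_bound y1 (P1 _ pP)) phi1).
    by rewrite (le_trans _ hp)// ltW.
  by rewrite hC.
apply: (@le_trans _ _ (vol (capcone y (sec t)^-1))).
  apply: le_measure; rewrite ?inE; [exact: measurable_capcone..|].
  move=> v [v1 hv]; split => //; apply: le_trans hv.
  by rewrite ler_wpM2r// enorm_ge0.
apply: le_trans (vol_capcone_le y1 t0) _.
rewrite tE -!EFinM lee_fin le_eqVlt; apply/orP; left; apply/eqP.
by field; rewrite !gt_eqF ?gam_gt0 ?kappa_gt0.
Qed.

(** The supremum over an empty family would be [-oo], so an empty cap has to be exhibited for every
    configuration. *)
Lemma disp_ge0 n : (0 <= disp R n d)%E.
Proof.
have b0 := kappa_gt0 R d.+1; have g0 := ccap_gt0 R d.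
apply: le_ereal_inf_tmp => _ [x x1 <-].
(* With this radius the average number of points in a cap is [n / n.+1 / 2], less than 1, so some
   cap contains none; [n.+1] covers [n = 0]. *)
have C0 : 0 < beta / (2 * ccap * n.+1%:R) by rewrite divr_gt0// !mulr_gt0 ?gam_gt0 ?kappa_gt0.
have [T T0 TE] := expr_root d0 C0.
have [y y1 hy] := few_in_cap T0 x1.
have h0 : #|[pred i | (sec T)^-1 <= inner y (x i)]| = 0%N.
  apply/eqP; rewrite -leqn0 -ltnS -(ltr_nat R) (le_lt_trans hy)// TE card_ord.
  have -> : n%:R * (ccap * (beta / (2 * ccap * n.+1%:R)) / beta) = n%:R / n.+1%:R / 2.
    by field; rewrite !gt_eqF ?gam_gt0 ?kappa_gt0.
  have : n%:R / n.+1%:R <= 1 :> R by rewrite ler_pdivrMr// mul1r ler_nat.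
  by move: (n%:R / n.+1%:R : R) => a; rewrite mulr1n; lra.
have s0 := sec_gt0 T; have s1 := sec_ge1 T.
have si : -1 <= (sec T)^-1 <= 1.
  have : 0 < (sec T)^-1 by rewrite invr_gt0.
  by rewrite invf_le1// s1 andbT; lra.
have phi1 : 0 <= acos (sec T)^-1 <= pi by rewrite acos_ge0// acos_lepi.
apply: (@le_trans _ _ (sigma (cap y (acos (sec T)^-1)))).
  by rewrite sigma_cap// mule_ge0// lee_fin invr_ge0 ltW.
apply: ereal_sup_ubound; exists (cap y (acos (sec T)^-1)) => //; split.
  by exists y, (acos (sec T)^-1).
apply/seteqP; split => // v [[_ hc] [i _ xv]].
move: hc; rewrite -xv (le_acos (sphere_bound y1 (x1 i)) phi1) acosK ?in_itv// => hi.
by have := card0_eq h0 i; rewrite inE hi.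
Qed.

Lemma covering_density_lt (b : R) : (covering_density R d < b%:E)%E ->
  exists x : nat -> 'rV[R]_d, exists l, [/\ \bigcup_i eball (x i) 1 = setT,
    has_covering_density x l%:E, 0 <= l & l < b].
Proof.
move=> /ereal_inf_lt[l [x [[_ xcov] xl]]] lb; exists x.
have l0 : (0 <= l)%E.
  rewrite leNgt; apply/negP => l0.
  have U : nbhs l [set y | (y < 0)%E].
    by apply: open_nbhs_nbhs; split; [exact: open_ereal_lt_ereal|].
  near (+oo_R) => r.
  have r0 : 0 < r by near: r; exact: nbhs_pinfty_gt.
  have : (\sum_(0 <= i <oo) (vol (eball (x i) 1 `&` eball 0 r) / vol (eball 0 r : set 'rV[R]_d)) < 0)%E.
    by near: r; exact: (xl _ U).
  apply/negP; rewrite -leNgt; apply: nneseries_ge0 => i _ _.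
  have v0 : 0 < r ^+ d * kappa R d by rewrite mulr_gt0 ?exprn_gt0 ?kappa_gt0.
  by rewrite vol_eball// inver gt_eqF// mule_ge0// lee_fin invr_ge0 ltW.
case: l xl lb l0 => [l| |]//; rewrite lte_fin lee_fin => xl lb l0.
by exists l.
Unshelve. all: by end_near. Qed.

(** Treats finite and infinite limits together: for [l = +oo] the lower bounds are divergence
    itself. *)
Lemma cvg_ereal_between (u : nat -> \bar R) (l : \bar R) : (0 <= l)%E ->
  (forall a : R, (a%:E < l)%E -> \forall n \near \oo, (a%:E <= u n)%E) ->
  (forall b : R, (l < b%:E)%E -> \forall n \near \oo, (u n <= b%:E)%E) ->
  u @ \oo --> l.
Proof.
case: l => [r| |]// _ lo hi.
- apply/fine_cvgP; split.
    have h1 : (((r - 1)%:E < r%:E))%E by rewrite lte_fin; lra.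
    have h2 : (r%:E < (r + 1)%:E)%E by rewrite lte_fin; lra.
    near=> n.
    have a1 : ((r - 1)%:E <= u n)%E by near: n; exact: lo.
    have a2 : (u n <= (r + 1)%:E)%E by near: n; exact: hi.
    by rewrite fin_numE; apply/andP; split; apply/eqP => E; move: a1 a2; rewrite E.
  apply/cvgrPdist_le => e e0.
  have h1 : (((r - e)%:E < r%:E))%E by rewrite lte_fin; lra.
  have h2 : (r%:E < (r + e)%:E)%E by rewrite lte_fin; lra.
  near=> n.
  have a1 : ((r - e)%:E <= u n)%E by near: n; exact: lo.
  have a2 : (u n <= (r + e)%:E)%E by near: n; exact: hi.
  move: a1 a2 => /=; case: (u n) => [v| |]//=; rewrite !lee_fin => a1 a2.
  by rewrite ler_norml; lra.
- by apply/cvgeyPge => A; apply: lo; rewrite ltry.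
Unshelve. all: by end_near. Qed.

End main.

Theorem theorem1p3 (R : realType) (d : nat) (hd : (2 <= d)%N) :
  (fun n : nat => n%:R%:E * disp R n d)%E @ \oo --> covering_density R d.
Proof.
have d0 : (0 < d)%N by exact: ltnW.
have disp0 n : (0 <= n%:R%:E * disp R n d)%E by rewrite mule_ge0 ?disp_ge0 ?lee_fin.
apply: cvg_ereal_between.
- rewrite leNgt; apply/negP => /covering_density_lt[x [l [_ _ l0 ll]]].
  by move: (le_lt_trans l0 ll); rewrite ltxx.
- move=> a ha; have [a0|a0] := leP a 0.
    by apply: nearW => n; apply: le_trans (disp0 n); rewrite lee_fin.
  (* Contrapositive: if [a] is not eventually a lower bound, [n * disp] is below [a] for arbitrarily
     large [n], and [disp_lower] bounds the density by [a]. *)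
  apply: contrapT => hn; move: ha; apply/negP; rewrite -leNgt.
  apply: (disp_lower d0 a0) => N; apply: contrapT => hN; apply: hn.
  exists N => // n /= Nn; rewrite leNgt; apply/negP => h.
  by apply: hN; exists n.
- move=> b /covering_density_lt[x [l [xcov xl l0 lb]]].
  have [N hN] := disp_upper d0 xcov xl lb (le_lt_trans l0 lb).
  by exists N => // n /=; exact: hN.
Qed.
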